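(* Let $G$ be a finite simple graph with $\operatorname{ht}(I(G))\geq 2$. Then $$\operatorname{reg}(I(G)^{\{2\}})\leq \min\big\{\operatorname{reg}(I(G))+2,\ \operatorname{match}(G)+2\big\}.$$ In particular, for every graph $G$ with $I(G)^{\{2\}}\neq 0$ we have $\operatorname{reg}(I(G)^{\{2\}})\leq \operatorname{match}(G)+2$.
   Context: Let $\mathbb{K}$ be a field and let $G$ be a finite simple graph with vertex set $\{x_1,\ldots,x_n\}$; vertices are identified with the variables of $S=\mathbb{K}[x_1,\ldots,x_n]$. The edge ideal is $I(G)=(x_ix_j : x_ix_j\in E(G))\subseteq S$; its height $\operatorname{ht}(I(G))$ equals the smallest cardinality of a vertex cover of $G$. For a squarefree monomial ideal $I$ with irredundant primary decomposition $I=\mathfrak{p}_1\cap\cdots\cap\mathfrak{p}_r$ (each $\mathfrak{p}_i$ generated by variables), the $s$-th symbolic power ($s\ge 1$) is $I^{(s)}=\mathfrak{p}_1^s\cap\cdots\cap\mathfrak{p}_r^s$. The squarefree part of a monomial ideal is the ideal generated by all squarefree monomials in it; $I^{\{s\}}$ denotes the squarefree part of $I^{(s)}$. For a graded $S$-module $M$ with graded Betti numbers $\beta_{i,j}(M)$, $\operatorname{reg}(M)=\max\{j-i : \beta_{i,j}(M)\neq 0\}$ (ideals are regarded as graded $S$-modules). $\operatorname{match}(G)$ is the maximum cardinality of a matching (set of pairwise disjoint edges) of $G$. *)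

(* Defs.v *)
From mathcomp Require Export all_boot all_order all_algebra.
From mathcomp Require Export mpoly.

Set Implicit Arguments.
Unset Strict Implicit.
Unset Printing Implicit Defensive.

Import GRing.Theory Num.Theory.
Local Open Scope ring_scope.

Section Ideals.
Variables (K : fieldType) (n : nat).
Local Notation S := {mpoly K[n]}.

(* Ideals are Prop-valued subsets of S; two ideals are compared by [sub_ideal]
   and [eq_ideal], never by Leibniz equality. *)
Definition sub_ideal (I J : S -> Prop) : Prop := forall f, I f -> J f.

Definition eq_ideal (I J : S -> Prop) : Prop := forall f, I f <-> J f.

Definition ideal_gen (A : S -> Prop) : S -> Prop := fun f =>
  exists s : seq (S * S),
    (forall p, p \in s -> A p.2) /\ f = \sum_(p <- s) p.1 * p.2.

Definition is_ideal (I : S -> Prop) : Prop :=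
  [/\ I 0, forall f g, I f -> I g -> I (f + g)
    & forall f g, I g -> I (f * g)].

Definition prime_ideal (I : S -> Prop) : Prop :=
  [/\ is_ideal I, ~ I 1 & forall f g, I (f * g) -> I f \/ I g].

Definition ideal_pow (I : S -> Prop) (s : nat) : S -> Prop :=
  ideal_gen (fun f =>
    exists t : s.-tuple S, (forall i, I (tnth t i)) /\ f = \prod_(i < s) tnth t i).

(* ht I >= h, where ht I is the infimum, over the primes p containing I, of the
   supremum of the lengths of the chains of primes descending from p. *)
Definition height_ge (I : S -> Prop) (h : nat) : Prop :=
  forall p, prime_ideal p -> sub_ideal I p ->
  exists c : nat -> S -> Prop,
    [/\ forall i, (i <= h)%N -> prime_ideal (c i),
        forall i, (i < h)%N -> sub_ideal (c i) (c i.+1) /\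
                               ~ sub_ideal (c i.+1) (c i)
      & eq_ideal (c h) p].

(* The prime ideal generated by the variables indexed by A. *)
Definition var_ideal (A : {set 'I_n}) : S -> Prop :=
  ideal_gen (fun f => exists2 i, i \in A & f = 'X_i).

Definition var_inter (D : {set {set 'I_n}}) : S -> Prop :=
  fun f => forall A, A \in D -> var_ideal A f.

Definition irredundant_decomposition (D : {set {set 'I_n}}) (I : S -> Prop)
    : Prop :=
  eq_ideal I (var_inter D) /\
  forall A, A \in D -> ~ eq_ideal I (var_inter (D :\ A)).

(* Only meaningful when I is a squarefree monomial ideal: then D exists and is
   unique. *)
Definition symbolic_power (I : S -> Prop) (s : nat) : S -> Prop := fun f =>
  exists2 D, irredundant_decomposition D I
           & forall A, A \in D -> ideal_pow (var_ideal A) s f.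

Definition squarefree_part (I : S -> Prop) : S -> Prop :=
  ideal_gen (fun f => exists m : 'X_{1..n},
    [/\ forall i, (m i <= 1)%N, f = 'X_[m] & I f]).

Definition sqfree_symbolic_power (I : S -> Prop) (s : nat) : S -> Prop :=
  squarefree_part (symbolic_power I s).

End Ideals.

Section Regularity.
Variables (K : fieldType) (n : nat).
Local Notation S := {mpoly K[n]}.

(* A sequence ... -> F_1 -> F_0 -> S of finitely generated graded free modules,
   where F_i has a basis of [res_rank i] elements, the k-th one of degree
   [res_deg i k].  Elements of F_i are row vectors and maps act by
   multiplication on the right.  Natural-number degrees suffice since only
   resolutions of ideals of S are considered. *)
Record free_complex : Type := FreeComplex {
  res_rank : nat -> nat;
  res_deg : forall i, 'I_(res_rank i) -> nat;
  res_aug : 'cV[S]_(res_rank 0);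
  res_diff : forall i, 'M[S]_(res_rank i.+1, res_rank i)
}.

(* The maps are homogeneous of degree 0. *)
Definition is_graded (F : free_complex) : Prop :=
  (forall k, res_aug F k 0 \is (res_deg k).-homog) /\
  (forall i a b m, m \in msupp (res_diff F i a b) ->
     res_deg a = (res_deg b + mdeg m)%N).

Definition is_resolution (F : free_complex) (I : S -> Prop) : Prop :=
  [/\ forall f, I f <-> exists v : 'rV[S]_(res_rank F 0),
        f = (v *m res_aug F) 0 0,
      forall v : 'rV[S]_(res_rank F 0),
        v *m res_aug F = 0 <-> exists w, v = w *m res_diff F 0
    & forall i (v : 'rV[S]_(res_rank F i.+1)),
        v *m res_diff F i = 0 <-> exists w, v = w *m res_diff F i.+1].

(* Every map F_{i+1} -> F_i has image in (x_1, ..., x_n) F_i. *)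
Definition is_minimal (F : free_complex) : Prop :=
  forall i a b, var_ideal [set: 'I_n] (res_diff F i a b).

Definition minimal_graded_free_resolution (F : free_complex) (I : S -> Prop)
    : Prop :=
  [/\ is_graded F, is_resolution F I & is_minimal F].

(* The graded Betti number beta_{i,j}, read off a minimal resolution. *)
Definition betti (F : free_complex) (i j : nat) : nat :=
  #|[set k : 'I_(res_rank F i) | res_deg k == j]|.

(* reg I = r, as a relation.  The zero ideal has no regularity; the choice of F
   is irrelevant since minimal graded free resolutions are unique up to
   isomorphism. *)
Definition is_reg (I : S -> Prop) (r : int) : Prop :=
  exists F : free_complex,
    [/\ minimal_graded_free_resolution F I,
        exists i j, betti F i j <> 0%N /\ j%:Z - i%:Z = r
      & forall i j, betti F i j <> 0%N -> j%:Z - i%:Z <= r].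

End Regularity.

Section Graphs.
Variables (K : fieldType) (n : nat).

(* The vertex i of the graph with adjacency relation e is the variable 'X_i. *)
Definition edge_ideal (e : rel 'I_n) : {mpoly K[n]} -> Prop :=
  ideal_gen (fun f => exists i j, e i j /\ f = 'X_i * 'X_j).

Definition edges (e : rel 'I_n) : {set {set 'I_n}} :=
  [set A | [exists i, exists j, e i j && (A == [set i; j])]].

Definition matching (e : rel 'I_n) (M : {set {set 'I_n}}) : bool :=
  (M \subset edges e) && trivIset M.

Definition match_number (e : rel 'I_n) : nat :=
  \max_(M : {set {set 'I_n}} | matching e M) #|M|.

End Graphs.

Arguments edge_ideal K {n} e _.

(* Main.v *)
(* A squarefree monomial ideal I is given by the upset U of the supports of its
   monomials.  Computing Tor(K, I) through the Koszul complex, one multidegree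
   at a time, turns beta_{i,j}(I) = 0 into: for every set W of j vertices, the
   cochain complex of the members of U contained in W is exact at size j - i
   (Hochster's formula).  So reg I is the largest size at which such a complex
   fails to be exact.

   For I(G) the complement of U consists of the independent sets, and for
   I(G)^{2} of the sets that are independent after removing one vertex.

   The bound reg I(G) + 2: enlarge the independent sets by allowing the removal
   of one more vertex v at a time.  The sets gained are v plus the independent
   sets B whose trace on N(v) is neither empty nor a single vertex y allowed
   before, and the relevant cohomology comes from the independent sets of W \ v,
   of W \ N[v] and of W \ (N[v] u N[y]).  The last one gains a degree because
   adding the edge vy to W \ (N[v] u N[y]) suspends its independence complex.

   The bound match(G) + 2 is an induction on W: delete a vertex x or pass to its
   link, and split the link by the number of neighbours of x in a set. *)
Require Import Defs.
From mathcomp Require Import zify ring.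
Set Implicit Arguments.
Unset Strict Implicit.
Unset Printing Implicit Defensive.
Import Order.TTheory GRing.Theory Num.Theory.
Local Open Scope ring_scope.

(** * Cochain complexes of families of sets *)

Section Signs.
Variables (R : comNzRingType) (n : nat).
Implicit Types (A B : {set 'I_n}) (x y : 'I_n).

Definition sg x A : R := (-1) ^+ #|[set z in A | (z < x)%N]|.

Lemma sg_sq x A : sg x A * sg x A = 1.
Proof. by rewrite /sg -exprD addnn -mul2n exprM sqrrN !expr1n. Qed.

Lemma sgU1 x y A : y \notin A -> sg x (y |: A) = (-1) ^+ (y < x)%N * sg x A.
Proof.
move=> yA; rewrite /sg -exprD; congr (_ ^+ _).
case yx: (y < x)%N.
  have -> : [set z in y |: A | (z < x)%N] = y |: [set z in A | (z < x)%N].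
    by apply/setP=> z; rewrite !inE; case: eqP => // ->; rewrite yx.
  by rewrite cardsU1 inE (negPf yA).
rewrite add0n; apply: eq_card => z; rewrite !inE.
by case: eqP => // ->; rewrite yx (negPf yA).
Qed.

(** Exactly one of [x < y] and [y < x] holds, so the two orders of insertion differ by a single
    sign. *)
Lemma sgC x y A : x != y -> x \notin A -> y \notin A ->
  sg x (y |: A) * sg y A = - (sg y (x |: A) * sg x A).
Proof.
move=> xy xA yA; rewrite !sgU1 //.
have := xy; rewrite -val_eqE /= neq_ltn => /orP[] lt; rewrite lt;
  rewrite [(_ < _)%N]ltnNge (ltnW lt) /= expr1 expr0; ring.
Qed.

(** The terms at [(x, y)] and [(y, x)] cancel by [sgC]. Values in a module make this serve both
    [cobound] and the Koszul differential [kdiff]. *)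
Lemma alternating_sum (V : lmodType R) A (G : 'I_n -> 'I_n -> V) :
    (forall x y, G x y = G y x) ->
  \sum_(x in A) \sum_(y in A :\ x)
     (sg x (A :\ x) * sg y (A :\ x :\ y)) *: G x y = 0.
Proof.
move=> symG.
under eq_bigr => x xA do rewrite (bigID (fun y : 'I_n => (y < x)%N)) /=.
rewrite big_split /=; apply/eqP; rewrite addr_eq0; apply/eqP.
rewrite (exchange_big_dep (fun y => y \in A)) /=; last first.
  by move=> x y xA /andP[/setD1P[]].
rewrite -sumrN; apply: eq_bigr => y yA; rewrite -sumrN.
apply: eq_big => [x|x].
  rewrite !inE yA -leqNgt ltn_neqAle val_eqE.
  by case: eqVneq => [->|]; rewrite ?eqxx ?andbF //= andbT => _; rewrite andbC.
case/andP=> xA /andP[/setD1P[yx _] ltyx].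
rewrite symG -scaleNr; congr (_ *: _).
have -> : A :\ x :\ y = A :\ y :\ x by rewrite setDDl setUC -setDDl.
have eqB z w : z \in A -> w \in A -> z != w -> A :\ z = w |: (A :\ z :\ w).
  by move=> zA wA zw; rewrite setD1K // !inE eq_sym zw.
rewrite {1}(eqB x y) // 1?eq_sym // {2}(eqB y x) //.
have -> : A :\ x :\ y = A :\ y :\ x by rewrite setDDl setUC -setDDl.
by rewrite sgC // 1?eq_sym // !inE eqxx ?andbF.
Qed.

End Signs.

Section Complex.
Variables (K : fieldType) (n : nat).
Local Notation vset := {set 'I_n}.
Implicit Types (A B C : {set 'I_n}) (P Q U : pred {set 'I_n}) (x y : 'I_n).
Implicit Types (f g : {set 'I_n} -> K) (t : nat).
Local Notation sg := (sg K).

Definition cobound P f A : K :=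
  \sum_(x in A | P (A :\ x)) sg x (A :\ x) * f (A :\ x).

(* The values of [f] and [g] outside the members of [P] of size [t], resp.
   [t.-1], are never read. *)
Definition exact_at t P : Prop := forall f,
  (forall A, P A -> #|A| = t.+1 -> cobound P f A = 0) ->
  exists g, forall A, P A -> #|A| = t -> f A = cobound P g A.

(** Convex families are the differences of two simplicial complexes, so [cobound] is a relative
    simplicial coboundary. *)
Definition convex P := forall A B C, A \subset B -> B \subset C ->
  P A -> P C -> P B.

Definition up_in P U := forall A B, A \subset B -> P B -> P A -> U A -> U B.

Definition downset P := forall A B, A \subset B -> P B -> P A.

Lemma downset_convex P : downset P -> convex P.
Proof. by move=> dP A B C _ sBC _; apply: dP. Qed.

Lemma eq_cobound P Q f A : P =1 Q -> cobound P f A = cobound Q f A.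
Proof. by move=> eqPQ; apply: eq_bigl => x; rewrite eqPQ. Qed.

Lemma eq_exact_at t P Q : P =1 Q -> exact_at t P -> exact_at t Q.
Proof.
move=> eqPQ exP f cf; have [|g gP] := exP f.
  by move=> A PA cA; rewrite (eq_cobound _ _ eqPQ) cf // -eqPQ.
by exists g => A QA cA; rewrite -(eq_cobound _ _ eqPQ) gP // eqPQ.
Qed.

Lemma exact_at_empty t P : (forall A, P A -> #|A| <> t) -> exact_at t P.
Proof. by move=> eP f _; exists (fun=> 0) => A /eP. Qed.

Lemma cobound_add P f g A :
  cobound P (fun B => f B + g B) A = cobound P f A + cobound P g A.
Proof. by rewrite /cobound -big_split; apply: eq_bigr => x _; rewrite mulrDr. Qed.

Lemma cobound_sub P f g A :
  cobound P (fun B => f B - g B) A = cobound P f A - cobound P g A.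
Proof.
rewrite /cobound -sumrN -big_split.
by apply: eq_bigr => x _; rewrite mulrDr mulrN.
Qed.

Lemma cobound_restrict P Q f A : (forall B, Q B -> P B) ->
  cobound P (fun B => if Q B then f B else 0) A = cobound Q f A.
Proof.
move=> sQP; rewrite /cobound big_mkcondr [RHS]big_mkcondr /=.
apply: eq_bigr => x _; case: ifP; case: ifP => //; rewrite ?mulr0 //.
by move/sQP => ->.
Qed.

(** Convexity puts [A :\ x] in [P] as soon as [A :\ x :\ y] and [A] are there, so all ordered pairs
    occur and [alternating_sum] applies with value 0 off [P]. *)
Lemma cobound_cobound P f A : convex P -> P A -> cobound P (cobound P f) A = 0.
Proof.
move=> cvP PA; rewrite /cobound.
rewrite -[RHS](@alternating_sum K n K^o A (fun x y =>
   if P (A :\ x :\ y) then f (A :\ x :\ y) else 0)); last first.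
  by move=> x y; rewrite !setDDl setUC.
rewrite big_mkcondr; apply: eq_bigr => x xA.
case: ifP => [_|nP].
  rewrite big_distrr big_mkcondr; apply: eq_bigr => y yA /=.
  by case: ifP => _; rewrite ?scaler0 // mulrA.
rewrite big1 // => y yA; case: ifP => [Py|_]; rewrite ?scaler0 //.
by move: nP; rewrite (cvP _ _ _ _ _ Py PA) // subD1set.
Qed.

(** * The long exact sequence of an upset in a convex family *)

Section LongExactSequence.
Variables (P U : pred {set 'I_n}).
Hypotheses (cvP : convex P) (upU : up_in P U).
Let PU := [pred A : vset | P A && U A].
Let PQ := [pred A : vset | P A && ~~ U A].
Let sU A : PU A -> P A. Proof. by case/andP. Qed.
Let sQ A : PQ A -> P A. Proof. by case/andP. Qed.

Lemma cobound_down f A : PQ A -> cobound PQ f A = cobound P f A.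
Proof.
case/andP=> PA nUA; apply: eq_bigl => x; rewrite /= andbA; case xA: (x \in A) => //=.
case PAx: (P _) => //=; apply/negP=> UAx.
by case/negP: nUA; apply: upU UAx => //; apply: subD1set.
Qed.

(** Cochains vanishing outside [U] are those of [PU]: in the long exact sequence [PU] gives the
    subcomplex and [PQ] the quotient. *)
Lemma cobound_up t f A : (forall B, PQ B -> #|B| = t -> f B = 0) ->
  #|A| = t.+1 -> cobound P f A = cobound PU f A.
Proof.
move=> f0 cA; rewrite /cobound big_mkcondr [RHS]big_mkcondr /=.
apply: eq_bigr => x xA; case PAx: (P _) => //=; case UAx: (U _) => //.
rewrite f0 ?mulr0 //=; first by rewrite PAx UAx.
by move: (cardsD1 x A); rewrite xA cA => -[].
Qed.

Lemma exact_at_extension t : exact_at t PU -> exact_at t PQ -> exact_at t P.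
Proof.
move=> exU exQ f cf; have [|g gP] := exQ f.
  by move=> A QA cA; rewrite cobound_down // cf // sQ.
(* Subtracting the coboundary of the zero extension of [g] makes [f] vanish on [PQ]; what is left is
   a cocycle of [PU]. *)
pose g1 B := if PQ B then g B else 0.
pose f1 B := f B - cobound P g1 B.
have f10 B : PQ B -> #|B| = t -> f1 B = 0.
  move=> QB cB; rewrite /f1 (gP _ QB cB) cobound_restrict; last exact: sQ.
  by rewrite subrr.
have [|h hP] := exU f1.
  move=> A UA cA; rewrite -(cobound_up f10 cA) cobound_sub cf ?sU //.
  by rewrite cobound_cobound ?subr0 // sU.
exists (fun B => g1 B + if PU B then h B else 0) => A PA cA.
rewrite cobound_add [X in _ + X]cobound_restrict; last exact: sU.
case UA: (U A).
  by rewrite -hP ?inE ?PA //= /f1 addrC subrK.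
have QA : PQ A by rewrite /= PA UA.
have /eqP := f10 A QA cA; rewrite subr_eq0 => /eqP ->.
rewrite [X in _ + X]/cobound [X in _ + X]big1 ?addr0 // => x /andP[xA /andP[PAx UAx]].
by case/negP: (negbT UA); apply: upU UAx => //; apply: subD1set.
Qed.

Lemma exact_at_up t : exact_at t.+1 P -> exact_at t PQ -> exact_at t.+1 PU.
Proof.
move=> exP exQ f cf.
pose f1 B := if PU B then f B else 0.
have f1Q A : PQ A -> cobound P f1 A = 0.
  move=> QA; rewrite -cobound_down // /cobound big1 // => x /andP[_ /andP[_ nU]].
  by rewrite /f1 /= (negPf nU) andbF mulr0.
have [|g gP] := exP f1.
  move=> A PA cA; case UA: (U A); last by rewrite f1Q //= PA UA.
  rewrite cobound_restrict; last exact: sU.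
  by rewrite cf //= PA UA.
(* [g] may be nonzero on [PQ], but it is a cocycle there because [f1] is zero on [PQ]; a primitive
   [h] on [PQ] corrects it. *)
have [|h hP] := exQ g.
  move=> A QA cA; rewrite cobound_down // -gP ?sQ // /f1 /=.
  by case/andP: QA => _ /negPf ->; rewrite andbF.
pose g1 B := g B - cobound P (fun B => if PQ B then h B else 0) B.
exists g1 => A UA cA; rewrite -(@cobound_up t) //; last first.
  move=> B QB cB; rewrite /g1 (hP _ QB cB) cobound_restrict; last exact: sQ.
  by rewrite subrr.
rewrite cobound_sub cobound_cobound ?sU // subr0 -gP ?sU // /f1.
by rewrite UA.
Qed.

Lemma exact_at_down t : exact_at t P -> exact_at t.+1 PU -> exact_at t PQ.
Proof.
move=> exP exU f cf.
pose f1 B := if PQ B then f B else 0.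
have f1Q A : PQ A -> #|A| = t.+1 -> cobound P f1 A = 0.
  by move=> QA cA; rewrite cobound_restrict ?cf // => B /sQ.
(* The connecting map: the coboundary of the zero extension of [f] is a cocycle supported on [U]. *)
have [|h hP] := exU (cobound P f1).
  move=> A UA cA.
  by rewrite -(cobound_up f1Q cA) cobound_cobound ?sU.
have [|g gP] := exP (fun B => f1 B - if PU B then h B else 0).
  move=> A PA cA; rewrite cobound_sub cobound_restrict; last exact: sU.
  case UA: (U A); first by rewrite hP ?subrr //= PA UA.
  rewrite f1Q //= ?PA ?UA // /cobound big1 ?subr0 // => x /andP[xA /andP[PAx UAx]].
  by case/negP: (negbT UA); apply: upU UAx => //; apply: subD1set.
exists g => A QA cA; rewrite cobound_down // -gP ?sQ // /f1 QA.
by case/andP: QA => PA /negPf nU /=; rewrite PA nU subr0.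
Qed.

End LongExactSequence.

(** Here [x] is the apex of a cone, and inserting [x] is a contracting homotopy. *)
Lemma exact_at_cone t P x : (forall A, P (A :\ x) = P A) -> exact_at t P.
Proof.
move=> cP f cf; have cPU A : P (x |: A) = P A.
  by rewrite -cP -[RHS]cP setDUl setDv set0U.
(* On sets containing [x] only the facet [A :\ x] contributes to the coboundary of [g]; on the
   others the cocycle condition at [x |: A] is solved for [f A]. *)
pose g B := if x \in B then 0 else sg x B * f (x |: B).
exists g => A PA cA; case xA: (x \in A).
  rewrite /cobound (bigD1 x) /= ?xA ?cP //= [X in _ + X]big1 ?addr0; last first.
    move=> y /andP[_ yx]; rewrite /g !inE eq_sym yx xA mulr0 //.
  by rewrite /g setD11 mulrA sg_sq mul1r setD1K.
have xA' : x \notin A by rewrite xA.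
have := cf (x |: A); rewrite cPU cardsU1 xA cA => /(_ PA erefl).
rewrite /cobound (bigD1 x) /=; last by rewrite setU11 setU1K ?xA.
rewrite setU1K // => /eqP; rewrite addr_eq0 => /eqP eqf.
rewrite -[f A]mul1r -(sg_sq _ x A) -mulrA eqf mulrN big_distrr -sumrN /=.
have eqx y : y \in A -> (x |: A) :\ y = x |: (A :\ y).
  move=> yA; apply/setP=> z; rewrite !inE; case: (eqVneq z x) => [->|]//.
  by rewrite andbT; apply/eqP=> xy; rewrite xy yA in xA.
apply: eq_big => [y|y].
  rewrite !inE; case: (eqVneq y x) => [->|yx] /=; first by rewrite xA andbF.
  by case yA: (y \in A) => //=; rewrite andbT eqx // cPU.
case/andP=> /andP[yxA _] yx.
have yA : y \in A by move: yxA; rewrite !inE (negPf yx).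
have xAy : x \notin A :\ y by rewrite !inE xA andbF.
rewrite eqx // /g (negPf xAy) !mulrA -mulNr; congr (_ * _).
have := @sgC K n x y (A :\ y); rewrite eq_sym yx xAy setD11 => /(_ isT isT isT).
rewrite setD1K //; set a := sg y (A :\ y); set b := sg x (A :\ y).
set c := sg y (x |: A :\ y) => e.
have -> : sg x A = - (c * b) * a by rewrite -e -mulrA sg_sq mulr1.
rewrite !mulNr opprK -(mulrA c) -(mulrA c) mulrC (mulrC b) -mulrA sg_sq.
by rewrite mulr1.
Qed.

(* The sign is that of moving [x] past [A] in the orientation. *)
Lemma cobound_link P f x A : (forall A, P A -> x \notin A) -> x \notin A ->
  cobound [pred B : vset | (x \in B) && P (B :\ x)] f (x |: A) =
  - sg x A * cobound P (fun B => sg x B * f (x |: B)) A.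
Proof.
move=> nP xA; rewrite /cobound big_distrr /=.
have eqx y : y \in A -> (x |: A) :\ y = x |: (A :\ y).
  move=> yA; apply/setP=> z; rewrite !inE; case: (eqVneq z x) => [->|]//.
  by rewrite andbT; apply/eqP=> xy; rewrite xy yA in xA.
apply: eq_big => [y|y].
  rewrite !inE; case: (eqVneq y x) => [->|yx] /=.
    by rewrite (negPf xA).
  rewrite eqxx /=; case yA: (y \in A) => //=.
  by rewrite eqx // setU1K // !inE negb_and xA orbT.
rewrite !inE => /andP[yxA /andP[/andP[xy _] _]].
have yA : y \in A by move: yxA; rewrite eq_sym (negPf xy).
have xAy : x \notin A :\ y by rewrite !inE negb_and xA orbT.
rewrite eqx // !mulrA; congr (_ * _).
rewrite -{2}(setD1K yA) mulNr sgC // ?setD11 // opprK.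
by rewrite -mulrA sg_sq mulr1.
Qed.

(** Inserting [x] identifies the two complexes up to the signs of [cobound_link] and raises the size
    by one. *)
Lemma exact_at_link t P x : (forall A, P A -> x \notin A) ->
  exact_at t.+1 [pred B : vset | (x \in B) && P (B :\ x)] <-> exact_at t P.
Proof.
move=> nP; set P' := [pred B : vset | _].
have PU A : P A -> P' (x |: A) by move=> PA; rewrite /= setU11 setU1K ?nP.
have cU A : P A -> #|x |: A| = #|A|.+1 by move=> /nP xA; rewrite cardsU1 xA.
have sg0 A : sg x A != 0 by rewrite signr_eq0.
split=> ex f cf.
  have [|g gP] := ex (fun B => sg x (B :\ x) * f (B :\ x)).
    move=> A /andP[xA PA] cA; rewrite -(setD1K xA) cobound_link //; last exact: nP.
    apply/eqP; rewrite mulf_eq0; apply/orP; right; apply/eqP.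
    rewrite -[RHS](cf _ PA); last by move: cA; rewrite (cardsD1 x) xA => -[].
    apply: eq_bigr => y /andP[_ /nP nx]; congr (_ * _).
    by rewrite setU1K // mulrA sg_sq mul1r.
  exists (fun B => - (sg x B * g (x |: B))) => A PA cA.
  have := gP (x |: A) (PU _ PA); rewrite cU // cA => /(_ erefl).
  rewrite setU1K ?nP // cobound_link ?nP // mulNr -mulrN => /(mulfI (sg0 A)) ->.
  by rewrite /cobound -sumrN; apply: eq_bigr => y _; rewrite mulrN.
have [|g gP] := ex (fun B => sg x B * f (x |: B)).
  move=> A PA cA; have := cf _ (PU _ PA); rewrite cU // cA => /(_ erefl).
  rewrite cobound_link ?nP // => /eqP; rewrite mulf_eq0 oppr_eq0 (negPf (sg0 _)).
  by move/eqP.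
exists (fun B => - (sg x (B :\ x) * g (B :\ x))) => A /andP[xA PA] cA.
have {}cA : #|A :\ x| = t by move: cA; rewrite (cardsD1 x) xA => -[].
have := gP _ PA cA; rewrite setD1K // => e.
rewrite -{2}(setD1K xA) (cobound_link _ nP) ?setD11 //.
apply: (mulfI (sg0 (A :\ x))); rewrite e mulrA mulrN sg_sq mulN1r.
rewrite /cobound -sumrN; apply: eq_bigr => y /andP[_ /nP nx].
by rewrite setU1K // mulrN mulrA sg_sq mul1r mulrN opprK.
Qed.

(** The members containing [x] form an upset in [P] and are the link of [x] shifted by one; the
    other members form the deletion. *)
Lemma exact_at_split t P x : convex P ->
  exact_at t.+1 [pred A : vset | P A && (x \notin A)] ->
  exact_at t [pred A : vset | (x \notin A) && P (x |: A)] -> exact_at t.+1 P.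
Proof.
move=> cvP exD exL; apply: (@exact_at_extension P [pred A : vset | x \in A]) => //.
  by move=> A B sAB _ _ /= /(subsetP sAB).
apply: eq_exact_at (proj2 (@exact_at_link t _ x _) exL) => [A|A /andP[]//].
rewrite /= setD11 andbC /=; case xA: (x \in A); rewrite ?andbF //= setD1K //.
Qed.

(** In the same sequence, the link in size [t] sits between the deletion in size [t] and [P] in size
    [t.+1]. *)
Lemma exact_at_link_of t P x : convex P -> exact_at t.+1 P ->
  exact_at t [pred A : vset | P A && (x \notin A)] ->
  exact_at t [pred A : vset | (x \notin A) && P (x |: A)].
Proof.
move=> cvP exP exQ; apply/(@exact_at_link t _ x) => [A /andP[]//|].
apply: eq_exact_at (@exact_at_up P [pred A : vset | x \in A] cvP _ t exP exQ) => [A|].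
  by rewrite /= setD11 andbC /=; case xA: (x \in A); rewrite //= setD1K.
by move=> A B sAB _ _ /= /(subsetP sAB).
Qed.

(** Any vertex of [W] is an apex. Size 0 is excluded because for empty [W] the empty set alone
    carries cohomology there. *)
Lemma exact_at_simplex t (W : vset) : exact_at t.+1 [pred A : vset | A \subset W].
Proof.
have [->|[x xW]] := set_0Vmem W.
  by apply: exact_at_empty => A; rewrite /= subset0 => /eqP ->; rewrite cards0.
apply: (@exact_at_cone _ _ x) => A /=; rewrite subDset.
by rewrite (setUidPr _) // sub1set.
Qed.

End Complex.

(** * Sets with at most one vertex in a given neighbourhood *)

Section Pieces.
Variables (K : fieldType) (n : nat).
Local Notation vset := {set 'I_n}.
Implicit Types (A B C W N : vset) (s : seq 'I_n).
Local Notation exact_at := (@exact_at K n).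

(** The list [s] of allowed single traces is what the induction of [exact_at_pieces] runs over. *)
Definition meets_at_most_once N s A :=
  (A :&: N == set0) || has (fun y => A :&: N == [set y]) s.

Lemma meets_at_most_once_sub N s A B : A \subset B ->
  meets_at_most_once N s B -> meets_at_most_once N s A.
Proof.
move=> /(setSI N) sAB /orP[/eqP B0|/hasP[y ys /eqP By]].
  by rewrite /meets_at_most_once -subset0 -B0 sAB.
move: sAB; rewrite By subset1 /meets_at_most_once => /orP[e|->] //.
by apply/orP; right; apply/hasP; exists y.
Qed.

(** Allowing one more trace [[set y]] adds an upset: the members [y |: C] with [C] disjoint from
    [N], which is a link shifted by one. *)
Lemma exact_at_pieces t (P : pred vset) N s : convex P ->
  exact_at t.+1 [pred A : vset | P A && (A :&: N == set0)] ->
  (forall y, y \in N ->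
     exact_at t [pred C : vset | (C :&: N == set0) && P (y |: C)]) ->
  exact_at t.+1 [pred A : vset | P A && meets_at_most_once N s A].
Proof.
move=> cvP ex0 exN; elim: s => [|y s IHs].
  by apply: eq_exact_at ex0 => A; rewrite /= /meets_at_most_once orbF.
have cvP' : convex [pred A : vset | P A && meets_at_most_once N (y :: s) A].
  move=> A B C sAB sBC /andP[PA _] /andP[PC mC] /=.
  by rewrite (cvP A B C) //= (meets_at_most_once_sub sBC).
pose U := [pred A : vset | ~~ meets_at_most_once N s A].
apply: (@exact_at_extension _ _ _ U cvP').
- move=> A B sAB _ _; apply: contra; exact: meets_at_most_once_sub.
(* If [y] lies outside [N] or is already in [s], no set is gained. *)
- have [yNs|nyNs] := boolP ((y \in N) && (y \notin s)); last first.
    apply: exact_at_empty => A /andP[/andP[_]].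
    rewrite /= /meets_at_most_once negb_or /=.
    move=> /or3P[->|/eqP e|/= h] /andP[] // nA /hasP[]; last by apply/hasP.
    have /setIP[yA yN] : y \in A :&: N by rewrite e set11.
    by exists y; rewrite ?e //; move: nyNs; rewrite yN /= negbK.
  case/andP: yNs => yN ys.
  have nyC C : (C :&: N == set0) && P (y |: C) -> y \notin C.
    case/andP=> /eqP e _; apply/negP=> yC.
    by have := in_set0 y; rewrite -e inE yC yN.
  apply: eq_exact_at (proj2 (@exact_at_link K n t _ y nyC) (exN y yN)) => A /=.
  case PA: (P A) => /=; last first.
    by apply/negP=> /and3P[yA _]; rewrite setD1K // PA.
  rewrite /meets_at_most_once /=.
  apply/idP/idP=> [/and3P[yA /eqP e _]|].
    have -> : A :&: N = [set y].
      by rewrite -(setD1K yA) setIUl e setU0; apply/setIidPl; rewrite sub1set.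
    rewrite eqxx orbT /= negb_or -cards_eq0 cards1 /=.
    by apply/hasPn=> z zs; apply: contra ys => /eqP/set1_inj ->.
  rewrite negb_or => /andP[/or3P[->|/eqP e _|/= ->]]; rewrite ?andbF //.
  have /setIP[yA _] : y \in A :&: N by rewrite e set11.
  by rewrite yA setD1K // PA andbT setIDAC e setDv eqxx.
- apply: eq_exact_at IHs => A /=; rewrite negbK /meets_at_most_once /=.
  by case: (P A) => //=; case: (_ == set0); case: (has _ s); rewrite ?orbT ?andbF.
Qed.

End Pieces.

(** * Independence complexes *)

Section Graph.
Variables (K : fieldType) (n : nat) (e : rel 'I_n).
Hypotheses (e_sym : ssrbool.symmetric e) (e_irr : ssrbool.irreflexive e).
Local Notation vset := {set 'I_n}.
Implicit Types (A B C W : vset) (s : seq 'I_n) (x y u v w : 'I_n) (q t : nat).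
Local Notation exact_at := (@exact_at K n).

Definition nbh v : vset := [set y | e v y].

Definition cnbh v : vset := v |: nbh v.

Definition indep A := [forall x in A, forall y in A, ~~ e x y].

Lemma indepP A : reflect (forall x y, x \in A -> y \in A -> ~~ e x y) (indep A).
Proof.
apply: (iffP forall_inP) => [h x y xA yA|h x xA]; first exact: (forall_inP (h x xA)).
by apply/forall_inP=> y; apply: h.
Qed.

Lemma indep_sub A B : A \subset B -> indep B -> indep A.
Proof. by move=> /subsetP sAB /indepP h; apply/indepP=> x y /sAB ? /sAB; apply: h. Qed.

Lemma indepU1 v A : indep (v |: A) = indep A && (A :&: nbh v == set0).
Proof.
apply/idP/andP=> [iA|[/indepP iA /eqP A0]].
  split; first by apply: indep_sub iA; apply: subsetUr.
  rewrite -subset0; apply/subsetP=> y; rewrite !inE => /andP[yA vy].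
  by move/indepP: iA => /(_ v y); rewrite vy !inE eqxx yA orbT => /(_ isT isT).
have nA y : y \in A -> ~~ e v y.
  by move=> yA; apply/negP=> vy; have := in_set0 y; rewrite -A0 !inE yA vy.
apply/indepP=> x y /setU1P[->|xA] /setU1P[->|yA].
- by rewrite e_irr.
- exact: nA.
- by rewrite e_sym nA.
- exact: iA.
Qed.

Definition indep_in W A := (A \subset W) && indep A.

Lemma indep_in_downset W : downset (indep_in W).
Proof.
by move=> A B sAB /andP[sBW iB]; rewrite /indep_in (subset_trans sAB) // (indep_sub sAB).
Qed.
Hint Resolve indep_in_downset : core.

Lemma indep_in_delete W x :
  [pred A : vset | indep_in W A && (x \notin A)] =1 indep_in (W :\ x).
Proof. by move=> A; rewrite /indep_in /= subsetD1 andbAC. Qed.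

Lemma subset_cnbh W v A : (A \subset W :\: cnbh v) =
  [&& A \subset W, v \notin A & A :&: nbh v == set0].
Proof.
rewrite setDUr subsetI subsetD1 subsetD setI_eq0.
by case: (A \subset W); case: (v \notin A).
Qed.

Lemma indep_in_link W x : x \in W ->
  [pred A : vset | (x \notin A) && indep_in W (x |: A)] =1
  indep_in (W :\: cnbh x).
Proof.
move=> xW A; rewrite /indep_in /= indepU1 subUset sub1set xW subset_cnbh.
by case: (A \subset W); case: (x \notin A); rewrite /= ?andbF // andbC.
Qed.

Lemma indep_in_avoid W x :
  [pred A : vset | indep_in (W :\ x) A && (A :&: nbh x == set0)] =1
  indep_in (W :\: cnbh x).
Proof.
move=> A; rewrite /indep_in /= subset_cnbh subsetD1.
by case: (A \subset W); case: (x \notin A); rewrite /= ?andbF // andbC.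
Qed.

Lemma indep_in_avoid_link W x y : y \in W -> y \in nbh x ->
  [pred C : vset | (C :&: nbh x == set0) && indep_in (W :\ x) (y |: C)] =1
  indep_in (W :\: cnbh x :\: cnbh y).
Proof.
move=> yW yx C; rewrite /indep_in /= !subset_cnbh indepU1 subUset sub1set.
have -> : (y \in W :\ x).
  by rewrite !inE yW andbT; apply: contraTneq yx => ->; rewrite inE e_irr.
rewrite subsetD1; case C0: (C :&: nbh x == set0); rewrite /= ?andbF //.
have -> : y \notin C.
  apply/negP=> yC; have := in_set0 y; rewrite -(eqP C0) inE yC yx //.
case: (C \subset W); case: (x \notin C); rewrite /= ?andbF //.
by rewrite andbC.
Qed.

(** The edge [u v] is isolated from [W], so adding it suspends the independence complex: the link of
    [u] is the complex of [W], and the deletion of [u] is a cone. *)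
Lemma exact_at_suspension t W u v : e u v -> [disjoint W & cnbh u :|: cnbh v] ->
  exact_at t.+1 (indep_in (u |: (v |: W))) -> exact_at t (indep_in W).
Proof.
move=> uv dW ex.
have := exact_at_link_of (x := u) (downset_convex (indep_in_downset (W:=u |: (v |: W)))) ex.
have nW z : z \in W -> [/\ z != u, z != v, ~~ e u z & ~~ e v z].
  by move/(disjointFr dW) => /negbT; rewrite !inE !negb_or => /andP[/andP[-> ->] /andP[-> ->]].
have -> : exact_at t (indep_in W) <-> exact_at t [pred A : vset |
   (u \notin A) && indep_in (u |: (v |: W)) (u |: A)].
  suff h : indep_in W =1 [pred A : vset |
     (u \notin A) && indep_in (u |: (v |: W)) (u |: A)].
    by split; apply: eq_exact_at.
  move=> A; have -> := indep_in_link (setU11 u (v |: W)) A.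
  rewrite /indep_in; congr (_ && _); apply/idP/idP => /subsetP sA; apply/subsetP=> z zA.
    by have := nW z (sA z zA); rewrite !inE => -[/negPf-> _ /negPf-> _]; rewrite (sA z zA) !orbT.
  have := sA z zA; rewrite !inE negb_or => /andP[/andP[/negPf -> uz]] /= /orP[/eqP zv|//].
  by rewrite zv uv in uz.
apply.
(* Without [u], the vertex [v] has no neighbour left, so it is an apex of the deletion. *)
apply: (@exact_at_cone _ _ _ _ v) => A /=; rewrite /indep_in.
have uv' : u != v by apply: contraTneq uv => ->; rewrite e_irr.
rewrite !inE (negPf uv') /=; case uA: (u \in A); rewrite ?andbF // !andbT.
have -> : (A :\ v \subset u |: (v |: W)) = (A \subset u |: (v |: W)).
  by rewrite subDset (setUidPr _) // sub1set !inE eqxx orbT.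
case sA: (A \subset _) => //=.
case vA: (v \in A); last first.
  by have -> : A :\ v = A by apply/setDidPl; rewrite disjoint_sym disjoints1 vA.
rewrite -[in RHS](setD1K vA) indepU1.
suff -> : (A :\ v) :&: nbh v == set0 by rewrite andbT.
rewrite -subset0; apply/subsetP=> z; rewrite !inE => /andP[/andP[zv zA] vz].
have := subsetP sA z zA; rewrite !inE (negPf zv) /= => /orP[/eqP zu|/nW[_ _ _]].
  by rewrite -zu zA in uA.
by rewrite vz.
Qed.

(* For [s = enum 'I_n]: the edges inside [A] have a common vertex. *)
Definition near_indep_at s A := indep A || has (fun v => indep (A :\ v)) s.

Definition near_indep_in s W A := (A \subset W) && near_indep_at s A.

Lemma near_indep_at_sub s A B : A \subset B -> near_indep_at s B -> near_indep_at s A.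
Proof.
move=> sAB /orP[/(indep_sub sAB) iA|/hasP[v vs iB]]; first by rewrite /near_indep_at iA.
apply/orP; right; apply/hasP; exists v => //.
by apply: indep_sub iB; apply: setSD.
Qed.

Lemma near_indep_in_downset s W : downset (near_indep_in s W).
Proof.
move=> A B sAB /andP[sBW iB].
by rewrite /near_indep_in (subset_trans sAB) // (near_indep_at_sub sAB).
Qed.
Hint Resolve near_indep_in_downset : core.

Lemma near_indep_at_link s v B : v \notin s -> v \notin B -> indep B ->
  near_indep_at s (v |: B) = meets_at_most_once (nbh v) s B.
Proof.
move=> vs vB iB; rewrite /near_indep_at /meets_at_most_once indepU1 iB /=.
case: eqP => //= B0; apply: eq_in_has => y ys.
have vy : v != y by apply: contraNneq vs => ->.
rewrite setDUl (_ : [set v] :\ y = [set v]); last first.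
  by apply/setDidPl; rewrite disjoints1 inE.
rewrite indepU1 (indep_sub _ iB) ?subD1set //= setIDAC setD_eq0 subset1.
by rewrite [_ == set0](introF eqP) ?orbF.
Qed.

(* The sets counted at [v :: s] but not at [s] all contain [v]: they are the
   independent sets plus [v] whose trace on [nbh v] is neither empty nor a
   single vertex of [s]. *)
Theorem exact_at_near_indep d : (0 < d)%N ->
  (forall W q, (d <= q)%N -> exact_at q (indep_in W)) ->
  forall s W q, (d <= q)%N -> exact_at q.+2 (near_indep_in s W).
Proof.
move=> d_gt0 exI s W q dq; elim: s => [|v s IHs].
  apply: eq_exact_at (exI W q.+2 _); last by lia.
  by move=> A; rewrite /near_indep_in /near_indep_at orbF.
(* A vertex outside [W] or already in [s] gains no set. *)
have [vWs|nvWs] := boolP ((v \in W) && (v \notin s)); last first.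
  apply: eq_exact_at IHs => A; rewrite /near_indep_in; case sA: (A \subset W) => //=.
  rewrite /near_indep_at /=; case iA: (indep A) => //=.
  move: nvWs; rewrite negb_and negbK => /orP[vW|vs].
    have -> : A :\ v = A; last by rewrite iA.
    apply/setDidPl; rewrite disjoint_sym disjoints1; apply: contra vW.
    exact: (subsetP sA).
  case iv: (indep (A :\ v)) => //=.
  by apply/hasP; exists v.
case/andP: vWs => vW vs.
pose U := [pred A : vset | ~~ near_indep_at s A].
apply: (@exact_at_extension _ _ _ U).
- exact: downset_convex.
- by move=> A B sAB _ _; apply: contra; apply: near_indep_at_sub.
(* The gained sets are [v |: B] with [B] in [V] and independent in [W :\ v]; the remaining
   independent sets have an allowed trace by [near_indep_at_link]. *)
- pose V := [pred B : vset | ~~ near_indep_at s (v |: B)].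
  have exV : exact_at q.+1 [pred B : vset | indep_in (W :\ v) B && V B].
    apply: exact_at_up; first exact: downset_convex.
    - move=> A B sAB _ _; apply: contra; apply: near_indep_at_sub; exact: setUS.
    - by apply: exI; lia.
    have -> : q = q.-1.+1 by lia.
    apply: (@eq_exact_at _ _ _ [pred A : vset | indep_in (W :\ v) A &&
                        meets_at_most_once (nbh v) s A]).
      move=> A /=; rewrite negbK; case iA: (indep_in _ A) => //=.
      case/andP: iA; rewrite subsetD1 => /andP[_ vA] iA.
      by rewrite near_indep_at_link.
    apply: exact_at_pieces; first exact: downset_convex.
      apply: eq_exact_at (exI (W :\: cnbh v) _ _); last by lia.
      by move=> A; rewrite -indep_in_avoid.
    move=> y yv; have [yW|yW] := boolP (y \in W); last first.
      apply: exact_at_empty => A /andP[_ /andP[]]; rewrite subUset sub1set !inE.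
      by rewrite (negPf yW) andbF.
    apply: (@eq_exact_at _ _ _ (indep_in (W :\: cnbh v :\: cnbh y))).
      by move=> A; rewrite indep_in_avoid_link.
    (* Size [q.-1] may be below [d]; adding the edge [v y] raises the size to [q], where the
       hypothesis applies. *)
    apply: (@exact_at_suspension _ _ v y); first by move: yv; rewrite inE.
      rewrite disjoint_sym disjoints_subset; apply/subsetP=> z; rewrite !inE.
      by case/orP=> ->; rewrite ?andbF.
    by apply: exI; lia.
  have nV A : indep_in (W :\ v) A && V A -> v \notin A.
    by case/andP=> /andP[]; rewrite subsetD1 => /andP[].
  apply: eq_exact_at (proj2 (@exact_at_link K n _ _ v nV) exV) => A /=.
  rewrite /near_indep_in /indep_in /near_indep_at /=.
  case vA: (v \in A) => /=.
    rewrite setD1K // subsetD1 setD11 andbT subDset (setUidPr _) ?sub1set //.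
    by case: (A \subset W); case: (indep A); case: (indep (A :\ v));
       case: (has _ s).
  have -> : A :\ v = A by apply/setDidPl; rewrite disjoint_sym disjoints1 vA.
  by case: (A \subset W); case: (indep A); case: (has _ s).
apply: eq_exact_at IHs => A; rewrite /near_indep_in /= negbK /near_indep_at /=.
by case: (A \subset W); case: (indep A); case: (indep (A :\ v)); case: (has _ s).
Qed.

End Graph.

(** * Matchings and near-independent sets *)

Section Matchings.
Variables (K : fieldType) (n : nat) (e : rel 'I_n).
Hypotheses (e_sym : ssrbool.symmetric e) (e_irr : ssrbool.irreflexive e).
Local Notation vset := {set 'I_n}.
Implicit Types (A B C W : vset) (s : seq 'I_n) (x y u v w : 'I_n) (q t : nat).
Local Notation exact_at := (@exact_at K n).
Local Notation nbh := (nbh e).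
Local Notation cnbh := (cnbh e).
Local Notation indep := (indep e).
Local Notation indep_in := (indep_in e).
Local Notation near_indep_at := (near_indep_at e (enum 'I_n)).
Local Notation near_indep_in := (near_indep_in e (enum 'I_n)).

Definition matchings_below W q :=
  forall M : {set vset}, matching e M -> cover M \subset W -> (#|M| < q)%N.

Lemma matchings_below_sub W W' q : W' \subset W ->
  matchings_below W q -> matchings_below W' q.
Proof. by move=> sW h M mM cM; apply: h => //; apply: subset_trans sW. Qed.

Lemma matchings_below_gt0 W q : matchings_below W q -> (0 < q)%N.
Proof.
move=> /(_ set0); rewrite cards0; apply; last by rewrite /cover big_set0 sub0set.
by rewrite /matching sub0set; apply/trivIsetP=> A B; rewrite inE.
Qed.

(** A matching inside [W'] stays a matching of [W] when the edge [x w] is added. *)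
Lemma matchings_below_edge W W' q x w : matchings_below W q.+1 ->
  e x w -> x \in W -> w \in W -> W' \subset W -> x \notin W' -> w \notin W' ->
  matchings_below W' q.
Proof.
move=> mW xw xW wW sW xW' wW' M /andP[sM tM] cM.
have nxM : x \notin cover M by apply: contra xW'; apply: (subsetP cM).
have nwM : w \notin cover M by apply: contra wW'; apply: (subsetP cM).
have dM B : B \in M -> [disjoint [set x; w] & B].
  move=> BM; rewrite disjoints_subset subUset !sub1set !inE; apply/andP; split.
    by apply: contra nxM => xB; apply/bigcupP; exists B.
  by apply: contra nwM => wB; apply/bigcupP; exists B.
have nM : [set x; w] \notin M.
  by apply: contra nxM => M1; apply/bigcupP; exists [set x; w]; rewrite // !inE eqxx.
have := mW ([set x; w] |: M); rewrite cardsU1 nM add1n ltnS; apply.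
  apply/andP; split.
    rewrite subUset sM andbT sub1set inE; apply/existsP; exists x.
    by apply/existsP; exists w; rewrite xw eqxx.
  apply/trivIsetP=> A B /setU1P[->|AM] /setU1P[->|BM]; rewrite ?eqxx //.
  - by move=> _; apply: dM.
  - by move=> _; rewrite disjoint_sym; apply: dM.
  - exact: (trivIsetP tM).
rewrite /cover bigcup_setU big_set1 -/(cover M) subUset (subset_trans cM) // andbT.
by rewrite subUset !sub1set xW.
Qed.

Lemma edge_or_indep W :
  (exists x y, [/\ x \in W, y \in W & e x y]) \/ indep W.
Proof.
case: (boolP (indep W)) => [|niW]; [by right|left].
move: niW; rewrite negb_forall_in => /exists_inP[x xW].
rewrite negb_forall_in => /exists_inP[y yW]; rewrite negbK => xy.
by exists x, y.
Qed.

(** This is the bound reg I(G) <= match(G) + 1 in terms of independent sets. At an edge [x w],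
    deleting [x] keeps the matching bound, and passing to the link of [x] lowers it by one. *)
Lemma exact_at_indep W q : matchings_below W q -> exact_at q (indep_in W).
Proof.
have [k] := ubnP #|W|; elim: k W q => // k IHk W q; rewrite ltnS => Wk mW.
have := matchings_below_gt0 mW; case: q mW => // q mW _.
have [[x [y [xW yW xy]]]|iW] := edge_or_indep W; last first.
  apply: eq_exact_at (@exact_at_simplex K n q W) => A /=; rewrite /indep_in.
  by case sA: (A \subset W) => //=; rewrite (indep_sub sA).
have ltx : (#|W :\ x| < k)%N by move: Wk; rewrite (cardsD1 x) xW.
apply: (@exact_at_split _ _ _ _ x).
- exact/downset_convex/indep_in_downset.
- apply: eq_exact_at (IHk (W :\ x) _ ltx _) => [A|]; first by rewrite -indep_in_delete.
  exact: matchings_below_sub (subD1set _ _) mW.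
apply: eq_exact_at (IHk (W :\: cnbh x) _ _ _) => [A||].
- by rewrite -indep_in_link.
- by apply: leq_trans ltx; rewrite ltnS subset_leq_card // setDS // sub1set setU11.
apply: (matchings_below_edge mW xy xW yW) => //; rewrite ?subsetDl ?inE ?eqxx //.
by rewrite ?inE xy orbT.
Qed.

Lemma near_indepP A : reflect (indep A \/ exists v, indep (A :\ v)) (near_indep_at A).
Proof.
apply: (iffP orP) => [[->|/hasP[v _ iv]]|[->|[v iv]]]; [by left|by right; exists v|by left|].
by right; apply/hasP; exists v; rewrite ?mem_enum.
Qed.

Lemma setU1D1 x v A : v != x -> (x |: A) :\ v = x |: (A :\ v).
Proof.
move=> vx; rewrite setDUl; congr (_ :|: _).
by apply/setDidPl; rewrite disjoints1 inE eq_sym.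
Qed.

Lemma near_indepU1_avoid x A : x \notin A -> A :&: nbh x = set0 ->
  near_indep_at (x |: A) = near_indep_at A.
Proof.
move=> xA A0; have iU B : B \subset A -> indep (x |: B) = indep B.
  by move=> sB; rewrite indepU1 // -subset0 -A0 setSI ?andbT.
apply/near_indepP/near_indepP; rewrite iU //; case=> [iA|[v iv]]; [by left| |by left|].
  have [vx|vx] := eqVneq v x; first by left; move: iv; rewrite vx setU1K.
  by right; exists v; move: iv; rewrite setU1D1 // iU ?subD1set.
have [vx|vx] := eqVneq v x.
  by left; move: iv; rewrite vx; apply: indep_sub; rewrite subsetD1 subxx.
by right; exists v; rewrite setU1D1 // iU ?subD1set.
Qed.

(** Only the removal of [x] or [y] breaks the edge [x y], and [C] survives it; conversely, removing
    [y] leaves [x] isolated over [C]. *)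
Lemma near_indepU2 x y C : e x y -> x \notin C -> C :&: nbh x = set0 ->
  near_indep_at (x |: (y |: C)) = indep C.
Proof.
move=> xy xC C0.
have nxy : x != y by apply: contraTneq xy => ->; rewrite e_irr.
have yC : y \notin C by apply/negP=> yC; have := in_set0 y; rewrite -C0 !inE yC xy.
apply/near_indepP/idP => [[|[v]]|iC].
- by apply: indep_sub; rewrite setUA subsetUr.
- have [->|vx] := eqVneq v x.
    by apply: indep_sub; rewrite subsetD1 xC setUA subsetUr.
  have [->|vy] := eqVneq v y.
    by apply: indep_sub; rewrite subsetD1 yC setUA subsetUr.
  move/indepP=> /(_ x y); rewrite xy !inE !eqxx !orbT /= !andbT.
  by rewrite eq_sym vx eq_sym vy => /(_ isT isT).
right; exists y; rewrite setU1D1 1?eq_sym // setU1K // indepU1 // iC C0 eqxx //.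
Qed.

(** Since [x] has at least two neighbours in [A], a single removal that leaves an independent set
    must remove [x]. *)
Lemma near_indepU1_meets x A : x \notin A -> 
  ~~ meets_at_most_once (nbh x) (enum 'I_n) A ->
  near_indep_at (x |: A) = indep A.
Proof.
move=> xA; rewrite negb_or => /andP[An0 /hasPn An1].
apply/near_indepP/idP => [[|[v]]|iA]; last by right; exists x; rewrite setU1K.
  by apply: indep_sub; apply: subsetUr.
have [->|vx] := eqVneq v x; first by rewrite setU1K.
rewrite setU1D1 // indepU1 // => /andP[_]; rewrite setIDAC setD_eq0 subset1.
by rewrite (negPf An0) (negPf (An1 v _)) ?mem_enum.
Qed.

Definition simplicial W x :=
  [forall y in W :&: nbh x, forall z in W :&: nbh x, (y != z) ==> e y z].

Lemma simplicial_meets W x A : simplicial W x -> A \subset W -> indep A ->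
  meets_at_most_once (nbh x) (enum 'I_n) A.
Proof.
move=> /forall_inP sx /subsetP sA /indepP iA; rewrite /meets_at_most_once.
case: eqP => //= /eqP /set0Pn[y yAx].
apply/hasP; exists y; rewrite ?mem_enum //; rewrite eqEsubset sub1set yAx andbT.
apply/subsetP=> z zAx; rewrite inE; apply/negPn/negP=> zy.
have /setIP[yA yx] := yAx; have /setIP[zA zx] := zAx.
have := iA _ _ zA yA; have := forall_inP (sx z _) y; rewrite !in_setI zx (sA z) // yx sA //.
by rewrite zy => /(_ isT) /= ->.
Qed.

Lemma not_simplicialP W x : ~~ simplicial W x -> exists y z,
  [/\ y \in W, z \in W, y != z & [/\ e x y, e x z & ~~ e y z]].
Proof.
rewrite /simplicial negb_forall_in => /exists_inP[y]; rewrite !inE => /andP[yW xy].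
rewrite negb_forall_in => /exists_inP[z]; rewrite !inE negb_imply.
move=> /andP[zW xz] /andP[yz nyz].
by exists y, z.
Qed.

(** Each end has two nonadjacent neighbours. Take [z != x] next to [y]; of the two neighbours of
    [x], one differs from both [y] and [z], because if one of them is [y], the other is not adjacent
    to [y]. *)
Lemma disjoint_edges W x y : ~~ simplicial W x -> ~~ simplicial W y -> 
    x \in W -> y \in W -> e x y ->
  exists y' z, [/\ y' \in W, z \in W, e x y' & e y z] /\
    [/\ y' != y, z != x & y' != z].
Proof.
move=> /not_simplicialP[y1 [y2 [y1W y2W y12 [xy1 xy2 ny12]]]].
move=> /not_simplicialP[z1 [z2 [z1W z2W z12 [yz1 yz2 nz12]]]] xW yW xy.
have [z [zW yz zx]] : exists z, [/\ z \in W, e y z & z != x].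
  have [z1x|] := eqVneq z1 x; last by exists z1.
  by exists z2; rewrite -z1x eq_sym.
have [e1|ne1] := eqVneq y1 y.
  exists y2, z; split=> //; rewrite -e1 eq_sym y12 zx; split=> //.
  by apply: contraNneq ny12 => ->; rewrite e1.
have [e2|ne2] := eqVneq y2 y.
  exists y1, z; split=> //; rewrite -e2 y12 zx; split=> //.
  by apply: contraNneq ny12 => ->; rewrite e2 e_sym.
have [e3|ne3] := eqVneq y1 z; last by exists y1, z.
exists y2, z; split=> //; split=> //; by rewrite -e3 eq_sym.
Qed.

(** A simplicial end of an edge is taken if there is one. Otherwise [disjoint_edges] yields two
    disjoint edges whose ends all lie in [cnbh x] or [cnbh y], so removing these sets lowers the
    matching bound by two. *)
Lemma good_vertex W q : matchings_below W q.+2 -> ~~ indep W ->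
  exists x w, [/\ x \in W, w \in W, e x w &
    simplicial W x \/ forall y, y \in W -> e x y ->
      matchings_below (W :\: cnbh x :\: cnbh y) q].
Proof.
move=> mW niW; have [[x [w [xW wW xw]]]|] := edge_or_indep W; last by rewrite (negPf niW).
have [/existsP[u /existsP[v /and4P[uW vW uv su]]]|ns] :=
  boolP [exists u, exists v, [&& u \in W, v \in W, e u v & simplicial W u]].
  by exists u, v; split => //; left.
have ns' u v : u \in W -> v \in W -> e u v -> ~~ simplicial W u.
  move=> uW vW uv; apply: contra ns => su.
  by apply/existsP; exists u; apply/existsP; exists v; rewrite uW vW uv.
exists x, w; split=> //; right=> y yW xy.
have yx : e y x by rewrite e_sym.
have [y' [z [[y'W zW xy' yz] [y'y zx y'z]]]] :=
  disjoint_edges (ns' _ _ xW wW xw) (ns' _ _ yW xW yx) xW yW xy.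
have nyx : y != x by apply: contraTneq xy => ->; rewrite e_irr.
apply: (@matchings_below_edge (W :\ x :\ y') _ q y z) => //.
- apply: (matchings_below_edge mW xy' xW y'W) => //; rewrite ?inE ?eqxx ?andbF //.
  by rewrite (subset_trans (subD1set _ _)) // subD1set.
- by rewrite !inE yW nyx eq_sym y'y.
- by rewrite !inE zW zx eq_sym y'z.
- apply/subsetP=> a; rewrite !inE !negb_or => /andP[/andP[ay nya] /andP[/andP[ax nxa] ->]].
  by rewrite ax !andbT; apply: contraNneq nxa => ->.
- by rewrite !inE eqxx.
- by rewrite !inE yz orbT.
Qed.

(* A simplicial vertex [x] leaves no independent set with two neighbours of
   [x]; if there is none, two disjoint edges [x y'], [y z] can be split off. *)
Theorem exact_at_near_indep_matching W q : matchings_below W q ->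
  exact_at q.+1 (near_indep_in W).
Proof.
have [k] := ubnP #|W|; elim: k W q => // k IHk W q; rewrite ltnS => Wk mW.
have dsN W' : downset (near_indep_in W') by apply: near_indep_in_downset.
have dsI W' : downset (indep_in W') by apply: indep_in_downset.
have [iW|niW] := boolP (indep W).
  apply: eq_exact_at (@exact_at_simplex K n q W) => A /=; rewrite /near_indep_in.
  by case sA: (A \subset W) => //=; rewrite /near_indep_at (indep_sub sA).
case: q mW (matchings_below_gt0 mW) => // q mW _.
(* A single edge is a matching, so the bound is at least 2; this makes room for the drop by two in
   [good_vertex]. *)
have [[x [w [xW wW xw]]]|] := edge_or_indep W; last by rewrite (negPf niW).
have mD : matchings_below (W :\ x :\ w) q.
  apply: (matchings_below_edge mW xw xW wW); rewrite ?inE ?eqxx ?andbF //.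
  by rewrite (subset_trans (subD1set _ _)) // subD1set.
case: q mW mD (matchings_below_gt0 mD) => // q mW mD _.
have {x w xW wW xw mD} [x [w [xW wW xw gx]]] := good_vertex mW niW.
have ltx : (#|W :\ x| < k)%N by move: Wk; rewrite (cardsD1 x) xW.
have ltNx : (#|W :\: cnbh x| < k)%N.
  by apply: leq_trans ltx; rewrite ltnS subset_leq_card // setDS // sub1set setU11.
have mNx : matchings_below (W :\: cnbh x) q.+1.
  apply: (matchings_below_edge mW xw xW wW); rewrite ?subsetDl ?inE ?eqxx //.
  by rewrite xw orbT.
pose L := [pred A : vset | (x \notin A) && near_indep_in W (x |: A)].
have dsL : downset L.
  move=> A B sAB /andP[xB LB]; apply/andP; split; last by apply: dsN LB; apply: setUS.
  by apply: contra xB; apply: (subsetP sAB).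
have LE A : (x \notin A) && near_indep_in W (x |: A) =
  [&& x \notin A, A \subset W & near_indep_at (x |: A)].
  by rewrite /near_indep_in subUset sub1set xW.
apply: (@exact_at_split _ _ _ _ x); first exact: downset_convex.
  apply: eq_exact_at (IHk (W :\ x) _ ltx (matchings_below_sub (subD1set _ _) mW)) => A.
  by rewrite /near_indep_in /= subsetD1 andbAC.
(* The link of [x] is cut by the number of neighbours of [x]. With two or more, its members are just
   independent sets by [near_indepU1_meets]. *)
pose U := [pred A : vset | ~~ meets_at_most_once (nbh x) (enum 'I_n) A].
apply: (@exact_at_extension _ _ L U); first exact: downset_convex.
- by move=> A B sAB _ _; apply: contra; apply: meets_at_most_once_sub.
- apply: (@eq_exact_at _ _ _ [pred A : vset | indep_in (W :\ x) A && U A]).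
    move=> A; rewrite [RHS]/= LE /= /indep_in subsetD1.
    case UA: (meets_at_most_once _ _ A); rewrite ?andbF //= !andbT.
    case xA: (x \in A); rewrite ?andbF //= andbT.
    by rewrite near_indepU1_meets ?xA // UA.
  case: gx => [sx|mx].
    apply: exact_at_empty => A /andP[/andP[]]; rewrite subsetD1 => /andP[sA _] iA /negP[].
    exact: simplicial_meets sx sA iA.
  apply: exact_at_up; first exact: downset_convex.
  + by move=> A B sAB _ _; apply: contra; apply: meets_at_most_once_sub.
  + by apply: exact_at_indep; apply: matchings_below_sub mW; apply: subD1set.
  apply: (@eq_exact_at _ _ _ [pred A : vset | indep_in (W :\ x) A &&
       meets_at_most_once (nbh x) (enum 'I_n) A]).
    by move=> A /=; rewrite negbK.
  apply: exact_at_pieces; first exact: downset_convex.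
    apply: eq_exact_at (exact_at_indep mNx) => A; by rewrite -indep_in_avoid.
  move=> y yx; have [yW|yW] := boolP (y \in W); last first.
    apply: exact_at_empty => A /andP[_ /andP[]]; rewrite subUset sub1set !inE.
    by rewrite (negPf yW) andbF.
  apply: (@eq_exact_at _ _ _ (indep_in (W :\: cnbh x :\: cnbh y))).
    by move=> A; rewrite indep_in_avoid_link.
  by apply: exact_at_indep; apply: mx => //; move: yx; rewrite inE.
apply: (@eq_exact_at _ _ _ [pred A : vset | L A &&
       meets_at_most_once (nbh x) (enum 'I_n) A]).
  by move=> A /=; rewrite negbK.
(* With no neighbour of [x], the link is the near-independent family of [W :\: cnbh x]; with the
   single neighbour [y], it is [y] added to the independent sets of [W :\: cnbh x]. *)
apply: exact_at_pieces; first exact: downset_convex.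
  apply: eq_exact_at (IHk _ _ ltNx mNx) => A; rewrite [RHS]/= LE.
  rewrite /near_indep_in subset_cnbh.
  case xA: (x \in A); rewrite ?andbF //=; case: eqP => [A0|]; rewrite ?andbF //.
  by rewrite !andbT near_indepU1_avoid ?xA.
move=> y yx; have xy : e x y by move: yx; rewrite inE.
have nyx : y != x by apply: contraTneq xy => ->; rewrite e_irr.
have [yW|yW] := boolP (y \in W); last first.
  apply: exact_at_empty => A /andP[_ /andP[_ /andP[]]]; rewrite !subUset !sub1set.
  by rewrite (negPf yW) andbF.
apply: eq_exact_at (exact_at_indep mNx) => A; rewrite [RHS]/= LE.
rewrite /indep_in subset_cnbh !inE subUset sub1set yW negb_or [x == y]eq_sym (negPf nyx) /=.
case xA: (x \in A); rewrite ?andbF //=; case: eqP => [A0|]; rewrite ?andbF //=.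
by rewrite near_indepU2 ?xA // andbT.
Qed.

End Matchings.

(** * Koszul homology of squarefree monomial ideals *)

Section Koszul.
Variables (K : fieldType) (n : nat).
Local Notation S := {mpoly K[n]}.
Local Notation vset := {set 'I_n}.
Local Notation exact_at := (@exact_at K n).
Implicit Types (m a : 'X_{1..n}) (f : S) (c : vset -> S) (T W : vset) (x : 'I_n) (p j : nat).
Implicit Types (U : pred vset).

Definition upset U := forall A B : vset, A \subset B -> U A -> U B.

Definition mnm_supp m : vset := [set i | m i != 0%N].

Definition sqf_ideal U f := forall m, m \in msupp f -> U (mnm_supp m).

(* The chain at [T] is the coefficient of the exterior monomial indexed by the
   complement of [T]; its multidegree is shifted by [co_mnm T]. *)
Definition co_mnm T : 'X_{1..n} := [multinom (i \notin T : nat) | i < n].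

(** Homological degree is the size of the complement. *)
Definition supported (V : zmodType) p (c : vset -> V) :=
  forall T, #|~: T| != p -> c T = 0.

Definition kpoly (c : vset -> S) T : S :=
  \sum_(x in T) sg S x (T :\ x) * ('X_x * c (T :\ x)).

(* The multidegree [a] part of the Koszul complex of [sqf_ideal U]. *)
Definition mpiece U a : pred vset := fun T =>
  (co_mnm T <= a)%MM && U (mnm_supp (a - co_mnm T)).

Lemma mdeg_co_mnm T : mdeg (co_mnm T) = #|~: T|.
Proof.
rewrite mdegE -sum1_card [RHS]big_mkcond /=; apply: eq_bigr => i _.
by rewrite mnmE inE; case: (i \in T).
Qed.

Lemma card_setC1 p T x : x \in T -> (#|~: (T :\ x)| == p.+1) = (#|~: T| == p).
Proof.
by move=> xT; rewrite setDE setCI setCK setUC cardsU1 inE xT.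
Qed.

Lemma co_mnmD1 T x : x \in T -> co_mnm (T :\ x) = (co_mnm T + U_(x))%MM.
Proof.
move=> xT; apply/mnmP=> i; rewrite mnmDE mnm1E !mnmE !inE.
by case: (eqVneq i x) => [->|ix] /=; rewrite ?xT ?addn0.
Qed.

Lemma mcoeff_sg x T f m : (sg S x T * f)@_m = sg K x T * f@_m.
Proof.
rewrite /sg -signr_odd mulr_sign -[in RHS]signr_odd mulr_sign.
by case: ifP; rewrite // mcoeffN.
Qed.

Lemma mcoeffXM x f m :
  ('X_x * f)@_m = if m x == 0%N then 0 else f@_(m - U_(x)).
Proof.
case: eqP => [mx|/eqP mx].
  apply/eqP; rewrite mcoeff_eq0 mulrC (perm_mem (msuppMX _ _)).
  apply/mapP=> -[m' _ em]; move: mx; rewrite em mnmDE mnm1E eqxx.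
  by rewrite ?addn1 ?add1n.
rewrite mulrC -{1}(@submK _ U_(x)%MM m) ?mcoeffMX //; last first.
  by apply/mnm_lepP=> i; rewrite mnm1E; case: eqP => // <-; rewrite lt0n.
by rewrite addmC mcoeffMX.
Qed.

Lemma mcoeff_kpoly U a c T : (forall T, sqf_ideal U (c T)) ->
  (co_mnm T <= a)%MM ->
  (kpoly c T)@_(a - co_mnm T) =
  cobound (mpiece U a) (fun T => (c T)@_(a - co_mnm T)) T.
Proof.
move=> cU /mnm_lepP leT; rewrite /kpoly /cobound raddf_sum big_mkcondr /=.
apply: eq_bigr => x xT; rewrite mcoeff_sg mcoeffXM.
have eax : (a - co_mnm T)%MM x = a x by rewrite mnmBE mnmE xT subn0.
rewrite eax; have eaT : (a - co_mnm T - U_(x) = a - co_mnm (T :\ x))%MM.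
  by rewrite co_mnmD1 //; apply/mnmP=> i; rewrite !mnmBE mnmDE subnDA.
have [a0|an0] := eqVneq (a x) 0%N.
  rewrite mulr0 ifF //; apply/negbTE; rewrite negb_and; apply/orP; left.
  by apply/negP=> /mnm_lepP/(_ x); rewrite mnmE a0 !inE eqxx.
rewrite eaT; case: ifP => //; rewrite /mpiece.
have -> /= : (co_mnm (T :\ x) <= a)%MM.
  apply/mnm_lepP=> i; rewrite co_mnmD1 // mnmDE mnm1E.
  case: (eqVneq x i) => [<-|_]; last by rewrite addn0.
  by rewrite mnmE xT lt0n.
move=> nU; rewrite [_@__](memN_msupp_eq0) ?mulr0 //.
by apply/negP=> /cU; rewrite nU.
Qed.

Lemma mcoeff_bounded_sum B (E : 'X_{1..n} -> K) m :
  (\sum_(v : 'X_{1..n < B}) E v *: 'X_[v] : S)@_m = if (mdeg m < B)%N then E m else 0.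
Proof.
case: ifP => [|mB]; first exact: mcoeff_mpoly.
rewrite raddf_sum big1 // => v _ /=; rewrite mcoeffZ mcoeffX.
by case: eqP => [ev|]; last (by rewrite mulr0); move: mB; rewrite -ev bmdeg.
Qed.

Lemma mnm_supp_sub m m' : (m <= m')%MM -> mnm_supp m \subset mnm_supp m'.
Proof.
move=> /mnm_lepP le; apply/subsetP=> i; rewrite !inE -!lt0n => h.
exact: leq_trans (le i).
Qed.

(** The equation is solved in each multidegree separately, and the coefficients are collected into
    polynomials. Exactness is asked only in multidegrees that occur in [c], so one total degree can
    be treated alone. *)
Lemma kpoly_exact U p c : upset U -> supported p c ->
    (forall T, sqf_ideal U (c T)) -> (forall T, kpoly c T = 0) ->
    (forall a T, (co_mnm T <= a)%MM -> (a - co_mnm T)%MM \in msupp (c T) ->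
       exact_at (n - p) (mpiece U a)) ->
  exists b, [/\ supported p.+1 b, forall T, sqf_ideal U (b T)
              & forall T, c T = kpoly b T].
Proof.
move=> upU supc cU c0 exa.
(* A multidegree of [c] is a monomial of some [c T] times [co_mnm T], whose degree is at most [n].
   From [B] on, the zero cochain solves the equation, so finitely many choices suffice. *)
pose B := (\max_T msize (c T) + n).+1.
have small a T : (co_mnm T <= a)%MM -> (a - co_mnm T)%MM \in msupp (c T) ->
    (mdeg a < B)%N.
  move=> leT /msize_mdeg_lt lt.
  have : (msize (c T) <= \max_T msize (c T))%N by apply: leq_bigmax.
  have := mdeg_co_mnm T; have := max_card (~: T); rewrite card_ord.
  have : (mdeg a = mdeg (a - co_mnm T) + mdeg (co_mnm T))%N by rewrite -mdegD submK.
  by rewrite /B; lia.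
have sizeT T : #|~: T| = p -> #|T| = (n - p)%N.
  by move=> cT; have := cardsC T; rewrite card_ord cT; lia.
have solve a : exists g, forall T, mpiece U a T -> #|~: T| = p ->
    (c T)@_(a - co_mnm T) = cobound (mpiece U a) g T.
  have [/existsP[T /andP[leT aT]]|no] :=
    boolP [exists T, (co_mnm T <= a)%MM && ((a - co_mnm T)%MM \in msupp (c T))].
    have [|g gP] := exa a T leT aT (fun T => (c T)@_(a - co_mnm T)).
      by move=> T' /andP[leT' _] _; rewrite -mcoeff_kpoly // c0 mcoeff0.
    by exists g => T' PT' /sizeT; apply: gP.
  exists (fun=> 0) => T' /andP[leT' _] _.
  rewrite /cobound big1 => [|x _]; last by rewrite mulr0.
  apply: memN_msupp_eq0; apply: contra no => aT'.
  by apply/existsP; exists T'; rewrite leT'.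
have [g0 g0P] := fin_all_exists (fun v : 'X_{1..n < B} => solve v).
pose g a : vset -> K := if insub a is Some v then g0 v else fun=> 0.
have gP a T : mpiece U a T -> #|~: T| = p ->
    (c T)@_(a - co_mnm T) = cobound (mpiece U a) (g a) T.
  move=> PT cT; rewrite /g; case: insubP => [v _ va|naB]; first by rewrite -va g0P // va.
  rewrite /cobound big1 => [|x _]; last by rewrite mulr0.
  apply: memN_msupp_eq0; apply: contra naB; apply: small.
  by case/andP: PT.
pose E T m := if mpiece U (m + co_mnm T) T then g (m + co_mnm T)%MM T else 0.
pose b T : S := if #|~: T| == p.+1 then \sum_(v : 'X_{1..n < B}) E T v *: 'X_[v] else 0.
have bE T m : (b T)@_m = if #|~: T| == p.+1 then E T m else 0.
  rewrite /b; case: ifP => _; last by rewrite mcoeff0.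
  rewrite mcoeff_bounded_sum; case: ifP => // mB.
  rewrite /E /g; case: ifP => // _; case: insubP => //= v vB _.
  by move: vB mB; rewrite mdegD; lia.
have supb : supported p.+1 b by move=> T /negPf nT; rewrite /b nT.
have bU T : sqf_ideal U (b T).
  move=> m; rewrite mcoeff_msupp bE; case: ifP => _; last by rewrite eqxx.
  rewrite /E; case: ifP => [/andP[_]|_]; last by rewrite eqxx.
  by rewrite addmK.
exists b; split=> // T; apply/mpolyP=> m.
have le : (co_mnm T <= m + co_mnm T)%MM by apply/mnm_lepP=> i; rewrite mnmDE leq_addl.
have -> : m = (m + co_mnm T - co_mnm T)%MM by rewrite addmK.
rewrite (mcoeff_kpoly bU le).
have [cT|ncT] := eqVneq #|~: T| p; last first.
  rewrite supc // mcoeff0 /cobound big1 // => x /andP[xT _].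
  by rewrite bE card_setC1 // (negPf ncT) mulr0.
have bG x : x \in T -> mpiece U (m + co_mnm T) (T :\ x) ->
    (b (T :\ x))@_(m + co_mnm T - co_mnm (T :\ x)) = g (m + co_mnm T)%MM (T :\ x).
  move=> xT Px; rewrite bE card_setC1 // cT eqxx /E submK ?Px //.
  by case/andP: Px.
have [PT|nPT] := boolP (mpiece U (m + co_mnm T) T).
  rewrite gP //; apply: eq_bigr => x /andP[xT Px]; by rewrite bG.
rewrite memN_msupp_eq0; last first.
  by apply: contra nPT => /cU; rewrite /mpiece le.
rewrite /cobound big_pred0 // => x; apply: contraNF nPT => /andP[xT /andP[lex Ux]].
rewrite /mpiece le /=; apply: upU Ux; apply: mnm_supp_sub.
apply/mnm_lepP=> i; rewrite !mnmBE co_mnmD1 // !mnmDE; lia.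
Qed.

(** Conversely, a cocycle becomes a Koszul cycle concentrated in multidegree [a], and the
    coefficients of a bounding chain give its primitive. *)
Lemma exact_at_mpiece U a p : (p <= n)%N -> upset U ->
  (forall c, supported p c -> (forall T, sqf_ideal U (c T)) ->
     (forall T, kpoly c T = 0) ->
     (forall T m, m \in msupp (c T) -> (m + co_mnm T)%MM = a) ->
     exists2 b, forall T, sqf_ideal U (b T) & forall T, c T = kpoly b T) ->
  exact_at (n - p) (mpiece U a).
Proof.
move=> pn upU exk f cf.
pose c T : S := if mpiece U a T && (#|~: T| == p) then f T *: 'X_[a - co_mnm T] else 0.
have msc T m : m \in msupp (c T) ->
    [/\ mpiece U a T, #|~: T| = p & m = (a - co_mnm T)%MM].
  rewrite /c; case: ifP => [/andP[-> /eqP ->]|_]; last by rewrite msupp0.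
  by move/msuppZ_le; rewrite msuppX inE => /eqP.
have cU T : sqf_ideal U (c T) by move=> m /msc[/andP[_ h] _ ->].
have sizeT T : (#|~: T| == p) = (#|T| == (n - p)%N).
  by have := cardsC T; rewrite card_ord; lia.
have sca T m : m \in msupp (c T) -> (m + co_mnm T)%MM = a.
  by move=> /msc[/andP[le _] _ ->]; rewrite submK.
have [||||b bU bP] := exk c => //.
- by move=> T /negPf nT; rewrite /c nT andbF.
- move=> T; apply/mpolyP=> m; rewrite mcoeff0.
  have le : (co_mnm T <= m + co_mnm T)%MM by apply/mnm_lepP=> i; rewrite mnmDE leq_addl.
  have -> : m = (m + co_mnm T - co_mnm T)%MM by rewrite addmK.
  rewrite (mcoeff_kpoly cU le).
  have [ma|ma] := eqVneq (m + co_mnm T)%MM a; last first.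
    rewrite /cobound big1 // => x /andP[xT /andP[lex _]].
    rewrite memN_msupp_eq0 ?mulr0 //; apply: contraNN ma => /sca.
    by rewrite submK // => ->.
  rewrite ma; have [cT|ncT] := eqVneq #|T| (n - p).+1; last first.
    rewrite /cobound big1 // => x /andP[xT _].
    rewrite memN_msupp_eq0 ?mulr0 //; apply: contraNN ncT => /msc[_ + _].
    by move/eqP; rewrite sizeT (cardsD1 x T) xT add1n eqSS.
  have [PT|nPT] := boolP (mpiece U a T).
    rewrite -[RHS](cf _ PT cT); apply: eq_bigr => x /andP[xT Px]; congr (_ * _).
    rewrite /c Px sizeT; move: cT; rewrite (cardsD1 x T) xT add1n => -[->].
    by rewrite eqxx /= mcoeffZ mcoeffX eqxx mulr1.
  rewrite /cobound big_pred0 // => x; apply: contraNF nPT => /andP[xT /andP[lex Ux]].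
  rewrite -ma in lex Ux *.
  rewrite /mpiece le /=; apply: upU Ux; apply: mnm_supp_sub.
  by apply/mnm_lepP=> i; rewrite !mnmBE co_mnmD1 // !mnmDE; lia.
exists (fun T => (b T)@_(a - co_mnm T)) => T PT cT.
have [le _] := andP PT.
rewrite -mcoeff_kpoly // -bP /c PT sizeT cT eqxx /=.
by rewrite mcoeffZ mcoeffX eqxx mulr1.
Qed.

(** The Koszul complex resolves [K]: in a nonzero multidegree [a], any [x] with [a x != 0] is an
    apex, and multidegree 0 meets only the constant terms for [p = 0]. *)
Lemma kpoly_free_exact p c : supported p c -> (forall T, kpoly c T = 0) ->
    (0 < p)%N \/ (forall T, (c T)@_0%MM = 0) ->
  exists2 b, supported p.+1 b & forall T, c T = kpoly b T.
Proof.
move=> supc c0 h.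
have [//|//|a T leT aT|b [supb _ bP]] := @kpoly_exact predT p c _ supc _ c0; last by exists b.
have /eqP an0 : a != 0%MM.
  apply/negP=> /eqP a0; move: leT aT; rewrite a0 => leT.
  have T0 : co_mnm T = 0%MM.
    by apply/mnmP=> i; move/mnm_lepP/(_ i): leT; rewrite mnm0E leqn0 => /eqP.
  rewrite T0 mcoeff_msupp subm0; case: h => [p_gt0|->]; last by rewrite eqxx.
  by rewrite supc ?mcoeff0 ?eqxx // -mdeg_co_mnm T0 mdeg0 eq_sym -lt0n.
have [x ax] : exists x, a x != 0%N.
  apply/existsP; apply/contraT; rewrite negb_exists => /forallP h0; case: an0.
  by apply/mnmP=> i; rewrite mnm0E; apply/eqP; move: (h0 i); rewrite negbK.
apply: (@exact_at_cone _ _ _ _ x) => A; rewrite /mpiece !andbT.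
apply/mnm_lepP/mnm_lepP => le i; move: (le i); rewrite !mnmE !inE.
  by case: (i == x) => //=; case: (i \in A).
by case: eqP => [->|] //=; rewrite lt0n ax.
Qed.

Lemma exact_at_join t (P : pred vset) (W Z : vset) :
    (forall A, P A -> A \subset W) -> [disjoint Z & W] ->
  exact_at (t + #|Z|) [pred A : vset | (Z \subset A) && P (A :\: Z)] <->
  exact_at t P.
Proof.
move=> PW; have [k] := ubnP #|Z|; elim: k Z => // k IHk Z; rewrite ltnS => Zk dZ.
have [Z0|[z zZ]] := set_0Vmem Z.
  rewrite Z0 cards0 addn0; have e : [pred A : vset | (set0 \subset A) && P (A :\: set0)] =1 P.
    by move=> A; rewrite /= sub0set setD0.
  by split; apply: eq_exact_at => // A; rewrite e.
have cZ : #|Z| = #|Z :\ z|.+1 by rewrite (cardsD1 z) zZ.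
have IH := IHk (Z :\ z) _ (disjointWl (subD1set _ _) dZ).
have {}IH := IH ltac:(by rewrite -cZ); rewrite cZ addnS.
have nz (A : vset) : (Z :\ z \subset A) && P (A :\: (Z :\ z)) -> z \notin A.
  case/andP=> _ /PW /subsetP sW; apply/negP=> zA; have := sW z.
  by rewrite !inE eqxx zA => /(_ isT); rewrite (disjointFr dZ zZ).
apply: iff_trans IH; apply: iff_trans (@exact_at_link K n _ _ z nz).
have e : [pred A : vset | (Z \subset A) && P (A :\: Z)] =1
   [pred B : vset | (z \in B) &&
     [pred A : vset | (Z :\ z \subset A) && P (A :\: (Z :\ z))] (B :\ z)].
  move=> A /=; rewrite subsetD1 setD11 andbT !setDDl setD1K //.
  rewrite andbA; congr (_ && _).
  by rewrite -{1}(setD1K zZ) subUset sub1set.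
by split; apply: eq_exact_at => // A; rewrite e.
Qed.

Lemma mpiece_sqfree U W T : mpiece U [multinom (i \in W : nat) | i < n] T =
  (~: W \subset T) && ((T :\: ~: W \subset W) && U (T :\: ~: W)).
Proof.
rewrite /mpiece.
have -> : (co_mnm T <= [multinom (i \in W : nat) | i < n])%MM = (~: W \subset T).
  apply/mnm_lepP/subsetP => h i; move: (h i); rewrite !mnmE !inE.
    by case: (i \in T); case: (i \in W).
  by case: (i \in T); case: (i \in W) => //= /(_ isT).
case: (boolP (~: W \subset T)) => //= sT.
rewrite setDE setCK subsetIr /=; congr (U _); apply/setP=> i; rewrite !inE mnmBE !mnmE.
have := subsetP sT i; rewrite !inE.
by case: (i \in T); case: (i \in W) => //= /(_ isT).
Qed.

Lemma mdeg_sqfree W : mdeg [multinom (i \in W : nat) | i < n] = #|W|.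
Proof.
rewrite mdegE -sum1_card [RHS]big_mkcond /=; apply: eq_bigr => i _.
by rewrite mnmE; case: (i \in W).
Qed.

(** The members of this piece are the members of [U] inside [W] with [~: W] adjoined;
    [exact_at_join] removes [~: W] and shifts the size. *)
Lemma exact_at_mpiece_sqfree U W p : (p <= #|W|)%N ->
  exact_at (n - p) (mpiece U [multinom (i \in W : nat) | i < n]) <->
  exact_at (#|W| - p) [pred A : vset | (A \subset W) && U A].
Proof.
move=> pW; pose P := [pred A : vset | (A \subset W) && U A].
have PW A : P A -> A \subset W by case/andP.
have dW : [disjoint ~: W & W] by rewrite disjoints_subset.
apply: iff_trans (@exact_at_join _ P W (~: W) PW dW).
have -> : (n - p = #|W| - p + #|~: W|)%N.
  by have := cardsC W; rewrite card_ord; lia.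
by split; apply: eq_exact_at => A; rewrite mpiece_sqfree.
Qed.

(** If [a x > 1], then [x] stays in the support whether or not it is in [T], so the piece is a cone;
    only squarefree multidegrees remain. *)
Lemma exact_at_mpiece_degree U a p : (p <= n)%N ->
    (forall W, #|W| = mdeg a -> (p <= #|W|)%N ->
       exact_at (#|W| - p) [pred A : vset | (A \subset W) && U A]) ->
  exact_at (n - p) (mpiece U a).
Proof.
move=> pn exW; have [pa|ap] := leqP p (mdeg a); last first.
  apply: exact_at_empty => A /andP[leA _] cA.
  have : (mdeg (co_mnm A) <= mdeg a)%N by rewrite -(submK leA) mdegD leq_addl.
  have := cardsC A; rewrite mdeg_co_mnm card_ord; lia.
have [/existsP[x ax]|] := boolP [exists x, (1 < a x)%N].
  apply: (@exact_at_cone _ _ _ _ x) => A; rewrite /mpiece.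
  have -> : (co_mnm (A :\ x) <= a)%MM = (co_mnm A <= a)%MM.
    apply/mnm_lepP/mnm_lepP => le i; move: (le i); rewrite !mnmE !inE.
      by case: (i == x) => //=; case: (i \in A).
    by case: eqP => [->|] //=; rewrite (ltnW ax).
  congr (_ && U _); apply/setP=> i; rewrite !inE !mnmBE !mnmE !inE.
  case: (eqVneq i x) => [ix|] //=; move: ax; rewrite -ix; case: (i \in A) => /=; lia.
rewrite negb_exists => /forallP a1; pose W := mnm_supp a.
have ea : a = [multinom (i \in W : nat) | i < n].
  by apply/mnmP=> i; rewrite mnmE inE; move: (a1 i); lia.
have cW : #|W| = mdeg a by rewrite [in RHS]ea mdeg_sqfree.
rewrite ea; apply/exact_at_mpiece_sqfree; first by rewrite cW.
by apply: exW; rewrite ?cW.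
Qed.

End Koszul.

(** * Koszul homology with coefficients in submodules of free modules *)

Section KoszulRows.
Variables (K : fieldType) (n : nat).
Local Notation S := {mpoly K[n]}.
Local Notation vset := {set 'I_n}.
Implicit Types (m : 'X_{1..n}) (T : vset) (x : 'I_n) (p j r s : nat).
Implicit Types (E : pred nat).

Definition kdiff r (c : vset -> 'rV[S]_r) T : 'rV[S]_r :=
  \sum_(x in T) sg S x (T :\ x) *: ('X_x *: c (T :\ x)).

(** A predicate on degrees lets [pred1 j] and [predC1 j] describe the two halves of
    [graded_split]. *)
Definition graded_in E r (deg : 'I_r -> nat) (c : vset -> 'rV[S]_r) :=
  forall T k m, m \in msupp (c T 0 k) -> E (mdeg m + deg k + #|~: T|)%N.

Definition graded_mx r s (dr : 'I_r -> nat) (ds : 'I_s -> nat) (D : 'M[S]_(r, s)) :=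
  forall a b m, m \in msupp (D a b) -> dr a = (ds b + mdeg m)%N.

(* Tor_p(K, Z)_j = 0; the degree of [b] need not be controlled. *)
Definition koszul_acyclic p j r (deg : 'I_r -> nat) (Z : 'rV[S]_r -> Prop) :=
  forall c, supported p c -> (forall T, Z (c T)) -> graded_in (pred1 j) deg c ->
    (forall T, kdiff c T = 0) ->
  exists b, [/\ supported p.+1 b, forall T, Z (b T) & forall T, c T = kdiff b T].

Definition im_mx r s (D : 'M[S]_(r, s)) (v : 'rV[S]_s) := exists w : 'rV[S]_r, v = w *m D.
Definition ker_mx r s (D : 'M[S]_(r, s)) (v : 'rV[S]_r) := v *m D = 0.

Lemma kdiffE r (c : vset -> 'rV[S]_r) T k :
  kdiff c T 0 k = kpoly (fun T => c T 0 k) T.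
Proof. by rewrite summxE; apply: eq_bigr => x _; rewrite !mxE. Qed.

Lemma kdiffB r (c d : vset -> 'rV[S]_r) T :
  kdiff (fun T => c T - d T) T = kdiff c T - kdiff d T.
Proof. by rewrite /kdiff -sumrB; apply: eq_bigr => x _; rewrite !scalerBr. Qed.

Lemma kdiff_mulmx r s (D : 'M[S]_(r, s)) (c : vset -> 'rV[S]_r) T :
  kdiff (fun T => c T *m D) T = kdiff c T *m D.
Proof. by rewrite /kdiff mulmx_suml; apply: eq_bigr => x _; rewrite -!scalemxAl. Qed.

Lemma eq_kdiff r (c d : vset -> 'rV[S]_r) T : c =1 d -> kdiff c T = kdiff d T.
Proof. by move=> cd; apply: eq_bigr => x _; rewrite cd. Qed.

Lemma kdiff_kdiff r (c : vset -> 'rV[S]_r) T : kdiff (kdiff c) T = 0.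
Proof.
rewrite -[RHS](@alternating_sum S n 'rV[S]_r T (fun x y =>
   ('X_x * 'X_y) *: c (T :\ x :\ y))); last first.
  by move=> x y; rewrite mulrC !setDDl setUC.
apply: eq_bigr => x xT; rewrite /kdiff !scaler_sumr; apply: eq_bigr => y yT.
by rewrite !scalerA; congr (_ *: _); rewrite mulrACA mulrA.
Qed.

Lemma supported_kdiff p r (c : vset -> 'rV[S]_r) :
  supported p.+1 c -> supported p (kdiff c).
Proof.
move=> sc T nT; rewrite /kdiff big1 // => x xT.
by rewrite sc ?scaler0 // card_setC1.
Qed.

Lemma supportedB p (V : zmodType) (c d : vset -> V) :
  supported p c -> supported p d -> supported p (fun T => c T - d T).
Proof. by move=> sc sd T nT; rewrite sc // sd // subrr. Qed.

Lemma msupp_sgX x T (f : S) m : m \in msupp (sg S x T * ('X_x * f)) ->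
  exists2 m', m' \in msupp f & m = (m' + U_(x))%MM.
Proof.
rewrite mcoeff_msupp mcoeff_sg mcoeffXM; have [m0|m0] := eqVneq (m x) 0%N.
  by rewrite mulr0 eqxx.
rewrite mulf_eq0 negb_or => /andP[_ fm]; exists (m - U_(x))%MM.
  by rewrite mcoeff_msupp.
rewrite submK //; apply/mnm_lepP=> i; rewrite mnm1E; case: eqP => // <-.
by rewrite lt0n.
Qed.

Lemma msupp_bigP (I : eqType) (l : seq I) (P : pred I) (F : I -> S) m :
  m \in msupp (\sum_(i <- l | P i) F i) ->
  exists i, [/\ i \in l, P i & m \in msupp (F i)].
Proof.
move=> /msupp_sum_le /flattenP[_ /mapP[i il ->] mF].
by move: il; rewrite mem_filter => /andP[Pi il]; exists i.
Qed.

Lemma graded_kdiff E r (deg : 'I_r -> nat) (c : vset -> 'rV[S]_r) :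
  graded_in E deg c -> graded_in E deg (kdiff c).
Proof.
move=> gc T k m; rewrite kdiffE => /msupp_bigP[x [_ xT]] /msupp_sgX[m' mc ->].
have := gc _ _ _ mc; congr E; rewrite mdegD mdeg1.
have /eqP := card_setC1 #|~: T| xT; rewrite eqxx => /eqP/eqP ->; lia.
Qed.

Lemma graded_mulmx E r s (dr : 'I_r -> nat) (ds : 'I_s -> nat) D (c : vset -> 'rV[S]_r) :
  graded_mx dr ds D -> graded_in E dr c -> graded_in E ds (fun T => c T *m D).
Proof.
move=> gD gc T k m; rewrite mxE => /msupp_bigP[a [_ _]].
move=> /msuppM_le /allpairsP[[m1 m2] /= [m1c m2D ->]].
have := gc _ _ _ m1c; rewrite (gD _ _ _ m2D) mdegD; by rewrite (addnC (ds k)) addnA.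
Qed.

Lemma gradedB E r (deg : 'I_r -> nat) (c : vset -> 'rV[S]_r) d :
  graded_in E deg c -> graded_in E deg d -> graded_in E deg (fun T => c T - d T).
Proof.
move=> gc gd T k m; rewrite !mxE => /msuppB_le; rewrite mem_cat => /orP[]; [exact: gc|exact: gd].
Qed.

Lemma graded_disjoint j r (deg : 'I_r -> nat) (c : vset -> 'rV[S]_r) T :
  graded_in (pred1 j) deg c -> graded_in (predC1 j) deg c -> c T = 0.
Proof.
move=> gc gd; apply/rowP=> k; rewrite mxE; apply: msuppnil0.
by case e: (msupp _) => [//|m l]; have := gc T k m; have := gd T k m;
  rewrite e mem_head => /(_ isT) /= nj /(_ isT) /= j1; rewrite j1 in nj.
Qed.

Lemma mpoly_filter (E : pred 'X_{1..n}) (f : S) : exists f1 : S,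
  (forall m, m \in msupp f1 -> E m) /\ forall m, m \in msupp (f - f1) -> ~~ E m.
Proof.
pose f1 : S := \sum_(v : 'X_{1..n < msize f}) (if E v then f@_v else 0) *: 'X_[v].
have f1E m : f1@_m = if E m then f@_m else 0.
  rewrite /f1 (mcoeff_bounded_sum _ (fun m => if E m then f@_m else 0)).
  case: ltnP => // /msize_mdeg_ge /memN_msupp_eq0 ->.
  by case: ifP.
exists f1; split=> m; rewrite mcoeff_msupp ?mcoeffB f1E; case: ifP => //; by rewrite ?subrr eqxx.
Qed.

Lemma graded_split p j r (deg : 'I_r -> nat) (c : vset -> 'rV[S]_r) : supported p c ->
  exists c1, [/\ supported p c1, graded_in (pred1 j) deg c1
               & graded_in (predC1 j) deg (fun T => c T - c1 T)].
Proof.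
move=> sc.
have ex (u : vset * 'I_r) : exists f1 : S,
    (forall m, m \in msupp f1 -> pred1 j (mdeg m + deg u.2 + #|~: u.1|)%N) /\
    (forall m, m \in msupp (c u.1 0 u.2 - f1) ->
       predC1 j (mdeg m + deg u.2 + #|~: u.1|)%N).
  exact: (mpoly_filter (fun m => pred1 j (mdeg m + deg u.2 + #|~: u.1|)%N)).
have [f fP] := fin_all_exists ex.
exists (fun T => if #|~: T| == p then \row_k f (T, k) else 0); split.
- by move=> T /negPf ->.
- move=> T k m; case: ifP => _; last by rewrite mxE msupp0.
  by rewrite mxE; apply: (fP (T, k)).1.
- move=> T k m; case: ifP => [_|/negbT /sc ->]; last by rewrite subr0 mxE msupp0.
  by rewrite !mxE; apply: (fP (T, k)).2.
Qed.

Lemma kdiff_free_exact p r (c : vset -> 'rV[S]_r) : supported p c ->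
    (forall T, kdiff c T = 0) -> (0 < p)%N \/ (forall T k, (c T 0 k)@_0%MM = 0) ->
  exists2 b, supported p.+1 b & forall T, c T = kdiff b T.
Proof.
move=> sc c0 h.
have ex (k : 'I_r) : exists b : vset -> S, supported p.+1 b /\
    forall T, c T 0 k = kpoly b T.
  have [|||b sb bP] := @kpoly_free_exact K n p (fun T => c T 0 k); last by exists b.
  - by move=> T /sc ->; rewrite mxE.
  - by move=> T; rewrite -kdiffE c0 mxE.
  - by case: h => h; [left|right].
have [b bP] := fin_all_exists ex.
exists (fun T => \row_k b k T) => T.
  by move=> nT; apply/rowP=> k; rewrite !mxE (bP k).1.
apply/rowP=> k; rewrite kdiffE (bP k).2.
by apply: eq_bigr => x _; rewrite mxE.
Qed.

Lemma lift_image p r s (D : 'M[S]_(r, s)) (c : vset -> 'rV[S]_s) : supported p c ->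
    (forall T, im_mx D (c T)) ->
  exists2 w, supported p w & forall T, c T = w T *m D.
Proof.
move=> sc cD; have [w wP] := fin_all_exists cD.
exists (fun T => if #|~: T| == p then w T else 0) => T; first by move/negPf=> ->.
by case: ifP => [_ //|/negbT/sc ->]; rewrite mul0mx.
Qed.

Section Shift.
Variables (r s : nat) (dr : 'I_r -> nat) (ds : 'I_s -> nat) (D : 'M[S]_(r, s)).
Hypothesis gD : graded_mx dr ds D.

(** Dimension shifting along 0 -> ker D -> F -> im D -> 0: a cycle is lifted to F, the differential
    of the lift bounds in the kernel, and the corrected lift bounds because F is free. *)
Lemma koszul_acyclic_image p j :
  koszul_acyclic p j dr (ker_mx D) -> koszul_acyclic p.+1 j ds (im_mx D).
Proof.
move=> exZ c sc cD gc c0; have [w sw cw] := lift_image sc cD.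
have [w1 [sw1 gw1 gw2]] := graded_split j dr sw.
have {}cw T : c T = w1 T *m D.
  apply/eqP; rewrite -subr_eq0; apply/eqP.
  apply: (@graded_disjoint j _ ds (fun T => c T - w1 T *m D)).
    by apply: gradedB => //; apply: graded_mulmx gw1.
  move=> {}T k m; rewrite cw -mulmxBl.
  exact: (graded_mulmx gD gw2).
have dwD T : kdiff w1 T *m D = 0.
  by rewrite -kdiff_mulmx -(c0 T); apply: eq_kdiff => ?; rewrite -cw.
have [||b [sb bZ bP]] := exZ (kdiff w1) (supported_kdiff sw1) dwD.
- exact: graded_kdiff.
- exact: kdiff_kdiff.
have [|||b0 sb0 b0P] := @kdiff_free_exact p.+1 r (fun T => w1 T - b T).
- exact: supportedB.
- by move=> T; rewrite kdiffB -bP subrr.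
- by left.
exists (fun T => b0 T *m D); split.
- by move=> T nT; rewrite sb0 // mul0mx.
- by move=> T; exists (b0 T).
- move=> T; rewrite kdiff_mulmx -b0P mulmxBl -cw.
  by rewrite [b T *m D]bZ subr0.
Qed.

(** The map from Tor_p of the kernel to Tor_p of F is zero: for [p > 0] since F is free, for [p = 0]
    since kernel vectors have no constant terms. *)
Lemma koszul_acyclic_kernel p j :
    (0 < p)%N \/ (forall v, ker_mx D v -> forall k, (v 0 k)@_0%MM = 0) ->
  koszul_acyclic p.+1 j ds (im_mx D) -> koszul_acyclic p j dr (ker_mx D).
Proof.
move=> minD exZ c sc cD gc c0.
have [|w sw cw] := @kdiff_free_exact p r c sc c0.
  by case: minD => h; [left|right=> T; apply: h].
have [w1 [sw1 gw1 gw2]] := graded_split j dr sw.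
have {}cw T : c T = kdiff w1 T.
  apply/eqP; rewrite -subr_eq0; apply/eqP.
  apply: (@graded_disjoint j _ dr (fun T => c T - kdiff w1 T)).
    by apply: gradedB => //; apply: graded_kdiff.
  move=> {}T k m; rewrite cw -kdiffB.
  exact: (graded_kdiff gw2).
have [||||b [sb bZ bP]] := exZ (fun T => w1 T *m D).
- by move=> T nT; rewrite sw1 // mul0mx.
- by move=> T; exists (w1 T).
- exact: graded_mulmx gw1.
- by move=> T; rewrite kdiff_mulmx -cw; apply: cD.
have [b' sb' b'P] := lift_image sb bZ.
exists (fun T => w1 T - kdiff b' T); split.
- by apply: supportedB => //; apply: supported_kdiff.
- move=> T; rewrite /ker_mx mulmxBl bP -kdiff_mulmx; apply/eqP; rewrite subr_eq0.
  by apply/eqP/eq_kdiff.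
- by move=> T; rewrite kdiffB kdiff_kdiff subr0.
Qed.

End Shift.

Lemma eq_koszul_acyclic p j r (deg : 'I_r -> nat) (Z Z' : 'rV[S]_r -> Prop) :
  (forall v, Z v <-> Z' v) -> koszul_acyclic p j deg Z -> koszul_acyclic p j deg Z'.
Proof.
move=> eqZ exZ c sc cZ gc c0; have [|b [sb bZ bP]] := exZ c sc _ gc c0.
  by move=> T; apply/eqZ.
by exists b; split=> // T; apply/eqZ.
Qed.

Section Ends.
Variables (r s : nat) (dr : 'I_r -> nat) (ds : 'I_s -> nat) (D : 'M[S]_(r, s)).
Hypothesis gD : graded_mx dr ds D.

(** If the class of [row k D] vanishes in Tor_0, the [k]-th basis vector minus a vector without
    constant terms lies in the kernel, which contradicts minimality. *)
Lemma no_generator j :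
    (forall v, ker_mx D v -> forall k, (v 0 k)@_0%MM = 0) ->
  koszul_acyclic 0 j ds (im_mx D) -> forall k, dr k <> j.
Proof.
move=> minD exZ k dk.
pose c T : 'rV[S]_s := if #|~: T| == 0%N then row k D else 0.
have sc : supported 0 c by move=> T /negPf nT; rewrite /c nT.
have [|||b [sb bZ bP]] := exZ c sc.
- move=> T; rewrite /c; case: ifP => _; last by exists 0; rewrite mul0mx.
  by exists (delta_mx 0 k); rewrite rowE.
- move=> T l m; rewrite /c; case: ifP => [/eqP ->|_]; last by rewrite mxE msupp0.
  by rewrite mxE => /gD; rewrite dk addn0 addnC /= => ->.
- move=> T; apply: big1 => x xT; rewrite sc ?scaler0 //.
  by rewrite -lt0n card_gt0; apply/set0Pn; exists x; rewrite !inE eqxx.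
have [w sw wP] := lift_image sb bZ.
have /minD /(_ k) : ker_mx D (delta_mx 0 k - kdiff w setT).
  rewrite /ker_mx mulmxBl -rowE -kdiff_mulmx.
  have -> : row k D = c setT by rewrite /c setCT cards0.
  by rewrite bP; apply/eqP; rewrite subr_eq0; apply/eqP/eq_kdiff.
rewrite !mxE !eqxx mcoeffB mcoeff1 eqxx kdiffE /kpoly raddf_sum big1 ?subr0.
  by move/eqP; rewrite oner_eq0.
by move=> x _ /=; rewrite mcoeff_sg mcoeffXM mnm0E eqxx mulr0.
Qed.

(** A constant term in a lift of total degree [j] would sit at a basis vector of degree [j]; hence
    the lift has none and bounds in the free module. *)
Lemma koszul_acyclic_no_generator j : (forall k, dr k <> j) ->
  koszul_acyclic 0 j ds (im_mx D).
Proof.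
move=> dj c sc cD gc c0; have [w sw cw] := lift_image sc cD.
have [w1 [sw1 gw1 gw2]] := graded_split j dr sw.
have {}cw T : c T = w1 T *m D.
  apply/eqP; rewrite -subr_eq0; apply/eqP.
  apply: (@graded_disjoint j _ ds (fun T => c T - w1 T *m D)).
    by apply: gradedB => //; apply: graded_mulmx gw1.
  move=> {}T k m; rewrite cw -mulmxBl.
  exact: (graded_mulmx gD gw2).
have [||b sb bP] := @kdiff_free_exact 0 r w1 sw1.
- move=> T; apply: big1 => x xT; rewrite sw1 ?scaler0 //.
  by rewrite -lt0n card_gt0; apply/set0Pn; exists x; rewrite !inE eqxx.
- right=> T k; have [cT|ncT] := eqVneq #|~: T| 0%N; last by rewrite sw1 // mxE mcoeff0.
  apply: memN_msupp_eq0; apply/negP=> /gw1; rewrite cT mdeg0 addn0 /= => /eqP.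
  exact: dj.
exists (fun T => b T *m D); split.
- by move=> T nT; rewrite sb // mul0mx.
- by move=> T; exists (b T).
- by move=> T; rewrite kdiff_mulmx -bP cw.
Qed.

End Ends.

End KoszulRows.

(** * Betti numbers *)

Section Resolutions.
Variables (K : fieldType) (n : nat).
Local Notation S := {mpoly K[n]}.
Local Notation vset := {set 'I_n}.
Local Notation exact_at := (@exact_at K n).
Variables (F : free_complex K n) (I : S -> Prop).

(** The augmentation becomes the map of index 0, with target S generated in degree 0. *)
Definition tgt_rank i := if i is i'.+1 then res_rank F i' else 1%N.

Definition tgt_deg i : 'I_(tgt_rank i) -> nat :=
  if i is i'.+1 then @res_deg _ _ F i' else fun=> 0%N.

Definition res_map i : 'M[S]_(res_rank F i, tgt_rank i) :=
  if i is i'.+1 then res_diff F i' else res_aug F.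

Hypothesis minF : minimal_graded_free_resolution F I.

Lemma graded_res_map i : graded_mx (@res_deg _ _ F i) (@tgt_deg i) (res_map i).
Proof.
have [[gaug gdiff] _ _] := minF; case: i => [|i] a b m /=; last exact: gdiff.
by rewrite ord1 => maug; have /dhomogP/(_ m maug) -> := gaug a.
Qed.

Lemma image_res_mapS i v : im_mx (res_map i.+1) v <-> ker_mx (res_map i) v.
Proof.
have [_ [_ ex0 exS] _] := minF.
by case: i v => [|i] v; [rewrite [ker_mx _ _]ex0|rewrite [ker_mx _ _]exS].
Qed.

Lemma var_ideal_mcoeff0 (A : vset) (f : S) : var_ideal A f -> f@_0%MM = 0.
Proof.
move=> [s [sA ->]]; rewrite raddf_sum big_seq big1 //= => q /sA[i _ ->].
by rewrite mulrC mcoeffXM mnm0E eqxx.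
Qed.

Lemma kernel_res_map_mcoeff0 i v : ker_mx (res_map i) v -> forall k, (v 0 k)@_0%MM = 0.
Proof.
move=> /image_res_mapS[w ->] k; have [_ _ minimal] := minF.
rewrite mxE raddf_sum big1 //= => a _.
by rewrite rmorphM /= (var_ideal_mcoeff0 (minimal i a k)) mulr0.
Qed.

Lemma koszul_acyclic_shift p i j :
  koszul_acyclic (i + p) j (@tgt_deg 0) (im_mx (res_map 0)) <->
  koszul_acyclic p j (@tgt_deg i) (im_mx (res_map i)).
Proof.
elim: i p => [//|i IHi] p; rewrite addSnnS; apply: iff_trans (IHi p.+1) _.
split=> ex.
  have exk := koszul_acyclic_kernel (@graded_res_map i)
     (or_intror (@kernel_res_map_mcoeff0 i)) ex.
  by apply: eq_koszul_acyclic exk => v; split=> /image_res_mapS.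
apply: (koszul_acyclic_image (@graded_res_map i)).
by apply: eq_koszul_acyclic ex => v; apply: image_res_mapS.
Qed.

Lemma bettiP i j : reflect (exists k, @res_deg _ _ F i k = j) (betti F i j != 0%N).
Proof.
rewrite /betti cards_eq0; apply: (iffP (set0Pn _)) => -[k].
  by rewrite inE => /eqP; exists k.
by move=> kj; exists k; rewrite inE kj.
Qed.

(** Shifting [i] times turns Tor_i of the ideal into Tor_0 of the image of the [i]-th map, which
    sees the basis of F_i by minimality. *)
Lemma koszul_acyclic_betti i j :
  koszul_acyclic i j (@tgt_deg 0) (im_mx (res_map 0)) <-> betti F i j = 0%N.
Proof.
apply: iff_trans (_ : koszul_acyclic 0 j (@tgt_deg i) (im_mx (res_map i)) <-> _).
  by rewrite -[in X in X <-> _](addn0 i); apply: koszul_acyclic_shift.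
split=> [ex|b0].
  apply/eqP/negPn/bettiP => -[k]; exact: (no_generator (@graded_res_map i)
    (@kernel_res_map_mcoeff0 i) ex).
apply: (koszul_acyclic_no_generator (@graded_res_map i)) => k dk.
have : betti F i j != 0%N by apply/bettiP; exists k.
by rewrite b0.
Qed.

Variable U : pred vset.
Hypotheses (upU : upset U) (IU : eq_ideal I (sqf_ideal U)).

Lemma image_augE v : im_mx (res_map 0) v <-> sqf_ideal U (v 0 0).
Proof.
have [_ [exI _ _] _] := minF.
apply: iff_trans (IU _); apply: iff_trans (iff_sym (exI _)).
split=> -[w e]; exists w; first by rewrite e.
by apply/rowP=> k; rewrite ord1 e.
Qed.

(** One half of Hochster's formula: a Koszul cycle of total degree [j] has terms only in
    multidegrees of degree [j]. *)
Lemma betti_eq0 i j :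
    (forall W : vset, #|W| = j -> (i <= #|W|)%N ->
       exact_at (#|W| - i) [pred A : vset | (A \subset W) && U A]) ->
  betti F i j = 0%N.
Proof.
move=> exW; apply/koszul_acyclic_betti => c sc cI gc c0.
have [||||b [sb bU bP]] := @kpoly_exact K n U i (fun T => c T 0 0) upU.
- by move=> T /sc ->; rewrite mxE.
- by move=> T; apply/image_augE.
- by move=> T; rewrite -kdiffE c0 mxE.
- move=> a T leT aT; have ej := gc _ _ _ aT.
  have iT : #|~: T| = i.
    by apply/eqP/contraT => /sc cT0; move: aT; rewrite cT0 mxE msupp0.
  apply: exact_at_mpiece_degree; first by rewrite -iT -[X in (_ <= X)%N]card_ord max_card.
  move=> W cW; apply: exW; rewrite cW -(eqP ej) /= addn0 -mdeg_co_mnm.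
  by rewrite -mdegD submK.
exists (fun T => (b T)%:M); split.
- by move=> T /sb ->; rewrite raddf0.
- by move=> T; apply/image_augE; rewrite mxE eqxx mulr1n; apply: bU.
- move=> T; apply/rowP=> k; rewrite kdiffE ord1 bP.
  by apply: eq_bigr => x _; rewrite mxE eqxx mulr1n.
Qed.

(** The other half: Koszul acyclicity in degree [#|W|] is read in the squarefree multidegree of
    [W]. *)
Lemma exact_at_betti (W : vset) p : (p <= #|W|)%N -> betti F p #|W| = 0%N ->
  exact_at (#|W| - p) [pred A : vset | (A \subset W) && U A].
Proof.
move=> pW /koszul_acyclic_betti ex; apply/exact_at_mpiece_sqfree => //.
apply: exact_at_mpiece => //.
  by apply: leq_trans pW _; rewrite -[X in (_ <= X)%N]card_ord max_card.
move=> c sc cU c0 ca.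
have [||||b [_ bI bP]] := ex (fun T => (c T)%:M).
- by move=> T /sc ->; rewrite raddf0.
- by move=> T; apply/image_augE; rewrite mxE eqxx mulr1n; apply: cU.
- move=> T k m; rewrite ord1 mxE eqxx mulr1n => /ca /= ea.
  by rewrite /= addn0 -mdeg_co_mnm -mdegD ea mdeg_sqfree eqxx.
- move=> T; apply/rowP=> k; rewrite kdiffE ord1 mxE -[RHS](c0 T).
  by apply: eq_bigr => x _; rewrite mxE eqxx mulr1n.
exists (fun T => b T 0 0) => T; first exact/image_augE.
by rewrite -kdiffE -bP mxE eqxx mulr1n.
Qed.

End Resolutions.

(** * Membership in monomial ideals, checked on monomials *)

Section MonomialIdeals.
Variables (K : fieldType) (n : nat).
Local Notation S := {mpoly K[n]}.
Local Notation vset := {set 'I_n}.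
Implicit Types (m : 'X_{1..n}) (f g : S) (A B C : vset) (i j : 'I_n).

Lemma ideal_gen_msupp (E : 'X_{1..n} -> Prop) (G : S -> Prop) f :
    (forall m m', E m' -> E (m + m')%MM) ->
    (forall g, G g -> forall m, m \in msupp g -> E m) ->
  ideal_gen G f -> forall m, m \in msupp f -> E m.
Proof.
move=> Eup GE [s [sG ->]] m /msupp_bigP[q [qs _]].
move=> /msuppM_le/allpairsP[[m1 m2] /= [_ m2q ->]].
exact/Eup/(GE _ (sG _ qs)).
Qed.

Lemma ideal_gen_monomials (G : S -> Prop) f :
    (forall m, m \in msupp f -> exists q g, G g /\ 'X_[m] = q * g) ->
  ideal_gen G f.
Proof.
rewrite (mpolyE f) => h; rewrite -mpolyE in h.
rewrite big_seq; apply: (big_ind (ideal_gen G)).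
- by exists [::]; split=> //; rewrite big_nil.
- move=> _ _ [s1 [G1 ->]] [s2 [G2 ->]]; exists (s1 ++ s2); split.
    by move=> q; rewrite mem_cat => /orP[/G1|/G2].
  by rewrite big_cat.
move=> m mf; have [q [g [Gg ->]]] := h m mf.
exists [:: (f@_m *: q, g)]; split=> [r|]; first by rewrite inE => /eqP ->.
by rewrite big_seq1 -scalerAl.
Qed.

Lemma mnm_suppD m m' : mnm_supp m' \subset mnm_supp (m + m')%MM.
Proof. by apply/subsetP=> i; rewrite !inE mnmDE addn_eq0 negb_and => ->; rewrite orbT. Qed.

Lemma mpolyX_factor m i : m i != 0%N -> 'X_[m] = 'X_[m - U_(i)] * 'X_i :> S.
Proof.
move=> mi; rewrite -mpolyXD submK //; apply/mnm_lepP=> j; rewrite mnm1E.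
by case: eqP => // <-; rewrite lt0n.
Qed.

Lemma var_idealP C f : var_ideal C f <->
  forall m, m \in msupp f -> exists2 i, i \in C & m i != 0%N.
Proof.
split=> [|h].
  apply: ideal_gen_msupp => [m m' [i iC mi]|_ [i iC ->] m].
    by exists i; rewrite // mnmDE addn_eq0 negb_and mi orbT.
  by rewrite msuppX inE => /eqP ->; exists i; rewrite // mnm1E eqxx.
apply: ideal_gen_monomials => m /h[i iC mi].
by exists 'X_[m - U_(i)], 'X_i; split; [exists i|rewrite -mpolyX_factor].
Qed.

Lemma var_ideal_square_mnm C m :
  ideal_pow (var_ideal C) 2 ('X_[m] : S) -> (1 < \sum_(i in C) m i)%N.
Proof.
move=> h; apply: (ideal_gen_msupp (E := fun m => (1 < \sum_(i in C) m i)%N) _ _ h);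
  last by rewrite msuppX inE.
- move=> m1 m2 /leq_trans; apply; apply: leq_sum => i _; rewrite mnmDE; exact: leq_addl.
move=> _ [t [tC ->]] m'; rewrite big_ord_recl big_ord1.
move=> /msuppM_le/allpairsP[[m1 m2] /= [h1 h2 ->]].
have [i iC mi] := (proj1 (var_idealP _ _) (tC _)) _ h1.
have [j jC mj] := (proj1 (var_idealP _ _) (tC _)) _ h2.
under eq_bigr do rewrite mnmDE.
by rewrite big_split /= (bigD1 i iC) [X in (_ + X)%N](bigD1 j jC) /=; lia.
Qed.

Lemma var_ideal_square_mem C m i j : i \in C -> j \in C -> i != j ->
  m i != 0%N -> m j != 0%N -> ideal_pow (var_ideal C) 2 ('X_[m] : S).
Proof.
move=> iC jC ij mi mj; apply: ideal_gen_monomials => m'; rewrite msuppX inE => /eqP ->.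
exists 'X_[m - U_(i) - U_(j)], ('X_j * 'X_i); split.
  exists [tuple 'X_j; 'X_i]; split; last by rewrite big_ord_recl big_ord1 !(tnth_nth 0).
  have XC k : k \in C -> var_ideal C ('X_k : S).
    move=> kC; apply/var_idealP => m''; rewrite msuppX inE => /eqP ->.
    by exists k; rewrite // mnm1E eqxx.
  by case=> [[|[|//]] lt2]; rewrite (tnth_nth 0) /=; apply: XC.
rewrite mulrA -mpolyX_factor -?mpolyX_factor //.
by rewrite mnmBE mnm1E (negPf ij) subn0.
Qed.

End MonomialIdeals.

(** * Edge ideals *)

Section EdgeIdeals.
Variables (K : fieldType) (n : nat) (e : rel 'I_n).
Hypotheses (e_sym : ssrbool.symmetric e) (e_irr : ssrbool.irreflexive e).
Local Notation S := {mpoly K[n]}.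
Local Notation vset := {set 'I_n}.
Local Notation exact_at := (@exact_at K n).
Local Notation indep := (indep e).
Local Notation near_indep_at := (near_indep_at e (enum 'I_n)).
Implicit Types (m : 'X_{1..n}) (f g : S) (A B C W : vset) (i j x y v : 'I_n).

Lemma not_indepP A : reflect (exists x y, [/\ x \in A, y \in A & e x y]) (~~ indep A).
Proof.
apply: (iffP idP) => [nA|[x [y [xA yA xy]]]].
  by have [//|iA] := edge_or_indep e A; rewrite iA in nA.
by apply/negP=> /indepP/(_ x y xA yA); rewrite xy.
Qed.

Lemma upset_not_indep : upset (fun A => ~~ indep A).
Proof. by move=> A B sAB; apply: contra; apply: indep_sub. Qed.

Lemma upset_not_near_indep : upset (fun A => ~~ near_indep_at A).
Proof. by move=> A B sAB; apply: contra; apply: near_indep_at_sub. Qed.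

Lemma edge_idealE : eq_ideal (edge_ideal K e) (sqf_ideal (fun A => ~~ indep A)).
Proof.
move=> f; split.
  apply: ideal_gen_msupp => [m m'|_ [i [j [ij ->]]] m].
    by apply: upset_not_indep; apply: mnm_suppD.
  rewrite -mpolyXD msuppX inE => /eqP ->; apply/not_indepP; exists i, j.
  by split; rewrite // inE mnmDE !mnm1E eqxx ?addn1 ?add1n.
move=> fU; apply: ideal_gen_monomials => m /fU/not_indepP[i [j [im jm ij]]].
rewrite inE in im; rewrite inE in jm.
exists 'X_[m - U_(i) - U_(j)], ('X_j * 'X_i); split.
  by exists j, i; rewrite e_sym.
rewrite mulrA -mpolyX_factor -?mpolyX_factor // mnmBE mnm1E.
by case: (eqVneq i j) => [ii|_]; [rewrite ii e_irr in ij|rewrite subn0].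
Qed.

Definition vertex_cover C := indep (~: C).

Lemma vertex_coverP C x y : vertex_cover C -> e x y -> (x \in C) || (y \in C).
Proof.
move=> /indepP h xy; apply/contraT; rewrite negb_or => /andP[xC yC].
by have := h x y; rewrite !inE xC yC xy => /(_ isT isT).
Qed.

Lemma edge_ideal_no_indep_monomial C m : indep (mnm_supp m) -> ~ edge_ideal K e 'X_[m].
Proof.
by move=> im /edge_idealE/(_ m); rewrite msuppX mem_head im => /(_ isT).
Qed.

Section Decomposition.
Variable D : {set vset}.
Hypothesis decD : irredundant_decomposition D (edge_ideal K e).

Lemma decomposition_cover C : C \in D -> vertex_cover C.
Proof.
move=> CD; apply/indepP=> x y; rewrite !inE => xC yC; apply/negP=> xy.
have : edge_ideal K e ('X_x * 'X_y).
  exists [:: (1, 'X_x * 'X_y)]; split; last by rewrite big_seq1 mul1r.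
  by move=> q; rewrite inE => /eqP ->; exists x, y.
move/(proj1 decD)/(_ C CD)/var_idealP/(_ (U_(x) + U_(y))%MM).
rewrite -mpolyXD msuppX mem_head => /(_ isT)[i iC].
rewrite mnmDE !mnm1E; case: (eqVneq x i) => [xi|_]; first by rewrite xi iC in xC.
by case: (eqVneq y i) => [yi|//]; rewrite yi iC in yC.
Qed.

(** The product of the variables outside [C] has independent support, so some component misses it.
    This handles every decomposition allowed in [symbolic_power] without its uniqueness. *)
Lemma decomposition_below C : vertex_cover C -> exists2 C', C' \in D & C' \subset C.
Proof.
move=> coverC; apply/exists_inP/contraT; rewrite negb_exists_in => /forall_inP no.
have [] := @edge_ideal_no_indep_monomial C [multinom (i \notin C : nat) | i < n].
  apply: indep_sub coverC; apply/subsetP=> i; rewrite !inE mnmE.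
  by case: (i \in C).
apply/(proj1 decD) => C' /no /subsetPn[i iC' iC]; apply/var_idealP => m.
by rewrite msuppX inE => /eqP ->; exists i; rewrite // mnmE iC.
Qed.

End Decomposition.

(** Dropping [C] lets in the product of the variables outside [C]. A monomial with independent
    support misses a minimal cover inside the complement of its support. *)
Lemma minimal_covers_decomposition :
  irredundant_decomposition [set C | minset vertex_cover C] (edge_ideal K e).
Proof.
split=> [f|C]; last first.
  rewrite inE => /minsetP[coverC minC] eqI.
  have [] := @edge_ideal_no_indep_monomial C [multinom (i \notin C : nat) | i < n].
    apply: indep_sub coverC; apply/subsetP=> i; rewrite !inE mnmE.
    by case: (i \in C).
  apply/eqI => C' /setD1P[neqC]; rewrite inE => /minsetP[coverC' _].
  have /subsetPn[i iC' iC] : ~~ (C' \subset C).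
    by apply: contra neqC => sC; rewrite (minC C').
  apply/var_idealP => m; rewrite msuppX inE => /eqP ->.
  by exists i; rewrite // mnmE iC.
apply: iff_trans (edge_idealE f) _; split=> [fU C|fD m mf].
  rewrite inE => /minsetp coverC; apply/var_idealP => m /fU.
  move=> /not_indepP[x [y []]]; rewrite !inE => mx my.
  by move/(vertex_coverP coverC)/orP=> -[h|h]; [exists x|exists y].
apply/negP=> im; have [|C minC sC] := @minset_exists _ vertex_cover (~: mnm_supp m).
  by rewrite /vertex_cover setCK.
have /var_idealP/(_ m mf)[i iC mi] : var_ideal C f by apply: fD; rewrite inE.
by have := subsetP sC i iC; rewrite !inE mi.
Qed.

(** If the support becomes an independent set [B] after at most one removal, the monomial has degree
    at most 1 in the cover [~: B], hence in a component below it. *)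
Lemma symbolic_square_near m : (forall i, (m i <= 1)%N) ->
  symbolic_power (edge_ideal K e) 2 'X_[m] -> ~~ near_indep_at (mnm_supp m).
Proof.
move=> m1 [D decD mD]; apply/negP=> nm.
have [B [iB leB]] : exists B, indep B /\ (\sum_(i in ~: B) m i <= 1)%N.
  case/near_indepP: nm => [iA|[v iA]].
    exists (mnm_supp m); split=> //; rewrite big1 // => i.
    by rewrite !inE negbK => /eqP.
  exists (mnm_supp m :\ v); split=> //; apply: leq_trans (m1 v).
  rewrite (bigD1 v) ?inE ?eqxx //= big1 ?addn0 // => i.
  by rewrite !inE => /andP[+ iv]; rewrite iv negbK => /eqP.
have [|C CD sC] := decomposition_below decD (C := ~: B); first by rewrite /vertex_cover setCK.
have := var_ideal_square_mnm (mD C CD).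
rewrite ltnNge => /negP; apply; apply: leq_trans leB.
rewrite big_mkcond [X in (_ <= X)%N]big_mkcond; apply: leq_sum => i _.
by case: ifP => // /(subsetP sC) ->.
Qed.

(** A component [C] meets an edge of the support at some [i], and still meets an edge after the
    removal of [i], at some [j != i]. *)
Lemma near_symbolic_square m : ~~ near_indep_at (mnm_supp m) ->
  symbolic_power (edge_ideal K e) 2 'X_[m].
Proof.
move=> nm; have decD := minimal_covers_decomposition.
exists [set C | minset vertex_cover C] => // C /(decomposition_cover decD) coverC.
have meets B : ~~ indep B -> exists2 i, i \in B & i \in C.
  move=> /not_indepP[x [y [xB yB /(vertex_coverP coverC)/orP[]]]]; [by exists x|by exists y].
have [|i im iC] := meets (mnm_supp m).
  by apply: contra nm => iA; apply/near_indepP; left.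
have [|j] := meets (mnm_supp m :\ i).
  by apply: contra nm => iA; apply/near_indepP; right; exists i.
rewrite !inE => /andP[ji jm] jC; rewrite inE in im.
by apply: (var_ideal_square_mem _ iC jC); rewrite // eq_sym.
Qed.

Lemma sqfree_symbolic_squareE :
  eq_ideal (sqfree_symbolic_power (edge_ideal K e) 2)
    (sqf_ideal (fun A => ~~ near_indep_at A)).
Proof.
move=> f; split.
  apply: ideal_gen_msupp => [m m'|_ [m [m1 -> hm]] m'].
    by apply: upset_not_near_indep; apply: mnm_suppD.
  by rewrite msuppX inE => /eqP ->; apply: symbolic_square_near.
move=> fU; apply: ideal_gen_monomials => m /fU nm.
(* The squarefree monomial with the support of [m]. *)
pose r : 'X_{1..n} := [multinom (m i != 0%N : nat) | i < n].
have er : mnm_supp r = mnm_supp m.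
  by apply/setP=> i; rewrite !inE mnmE; case: (m i).
exists 'X_[m - r], 'X_[r]; split.
  exists r; split=> //; first by move=> i; rewrite mnmE; case: (m i).
  by apply: near_symbolic_square; rewrite er.
by rewrite -mpolyXD submK //; apply/mnm_lepP=> i; rewrite mnmE; case: (m i).
Qed.

(** * From regularity to exactness and back *)

Lemma exact_at_reg_edge r : is_reg (edge_ideal K e) r -> forall W t, r < t%:Z ->
  exact_at t [pred A : vset | (A \subset W) && ~~ indep A].
Proof.
move=> [F [minF _ leF]] W t rt; have [tW|Wt] := leqP t #|W|; last first.
  by apply: exact_at_empty => A /andP[/subset_leq_card]; lia.
have := exact_at_betti minF upset_not_indep edge_idealE (leq_subr t #|W|).
rewrite subKn //; apply; apply/eqP/contraT => /eqP/leF.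
by rewrite leNgt => /negP[]; move: rt; lia.
Qed.

Lemma reg_edge_has_edge r : is_reg (edge_ideal K e) r -> exists x y, e x y.
Proof.
move=> [F [minF [i [j [bij _]]] _]].
have [[x [y [_ _ xy]]]|iT] := edge_or_indep e setT; first by exists x, y.
case: bij; apply: (betti_eq0 minF upset_not_indep edge_idealE) => W _ _.
apply: exact_at_empty => A /andP[_]; rewrite (indep_sub _ iT) //; exact: subsetT.
Qed.

(** For an edge [x y], the constant cochain 1 on [[set x; y]] is a cocycle, since no larger set
    fits, and not a coboundary, since all smaller sets are independent. *)
Lemma reg_edge_ge2 r : is_reg (edge_ideal K e) r -> 2 <= r.
Proof.
move=> reg; have [x [y xy]] := reg_edge_has_edge reg.
rewrite leNgt; apply/negP=> r2.
have nxy : x != y by apply: contraTneq xy => ->; rewrite e_irr.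
have [A /andP[/subset_leq_card]|g gP] := @exact_at_reg_edge r reg [set x; y] 2 r2 (fun=> 1).
  by rewrite cards2 => + _ cA; rewrite cA; case: (_ != _).
have nI : ~~ indep [set x; y] by apply/not_indepP; exists x, y; rewrite !inE !eqxx orbT.
have := gP [set x; y]; rewrite /= subxx cards2 nxy => /(_ nI erefl).
rewrite /cobound big_pred0 => [/eqP|z]; first by rewrite oner_eq0.
apply/negP=> /andP[zxy /andP[_ /not_indepP[a [b [az bz ab]]]]].
have : #|[set x; y] :\ z| = 1%N.
  by have := cardsD1 z [set x; y]; rewrite zxy cards2 nxy => -[].
case/eqP/cards1P=> c ec; move: az bz; rewrite ec !inE => /eqP ac /eqP bc.
by rewrite ac bc e_irr in ab.
Qed.

(** All subsets of [W] form a simplex, so the connecting map moves exactness from a subcomplex to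
    its complement, one size up. *)
Lemma exact_at_not_near t W : exact_at t.+1 (near_indep_in e (enum 'I_n) W) ->
  exact_at t.+2 [pred A : vset | (A \subset W) && ~~ near_indep_at A].
Proof.
move=> ex; have dsW : downset [pred A : vset | A \subset W].
  by move=> A B /subset_trans sAB /sAB.
apply: (@exact_at_up K n _ (fun A => ~~ near_indep_at A) (downset_convex dsW)).
- by move=> A B sAB _ _; apply: upset_not_near_indep.
- exact: exact_at_simplex.
by apply: eq_exact_at ex => A; rewrite /= negbK.
Qed.

Lemma exact_at_indep_reg r : is_reg (edge_ideal K e) r -> forall W q,
  r <= q%:Z -> exact_at q (indep_in e W).
Proof.
move=> reg W q rq; have r2 := reg_edge_ge2 reg.
have dsW : downset [pred A : vset | A \subset W].
  by move=> A B /subset_trans sAB /sAB.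
have := @exact_at_down K n _ (fun A => ~~ indep A) (downset_convex dsW) _ q.
move=> h; apply: (eq_exact_at (P := [pred A : vset | (A \subset W) && ~~ ~~ indep A])).
  by move=> A; rewrite /= negbK.
apply: h.
- by move=> A B sAB _ _; apply: upset_not_indep.
- have -> : q = q.-1.+1 by lia.
  exact: exact_at_simplex.
by apply: exact_at_reg_edge reg _ _ _; lia.
Qed.

Lemma reg_sqfree_symbolic_square_le (d : nat) r2 :
    (forall W t, (d < t)%N ->
       exact_at t [pred A : vset | (A \subset W) && ~~ near_indep_at A]) ->
    is_reg (sqfree_symbolic_power (edge_ideal K e) 2) r2 -> r2 <= d%:Z.
Proof.
move=> ex [F [minF [i [j [bij <-]]] _]]; rewrite leNgt; apply/negP=> lt.
case: bij; apply: (betti_eq0 minF upset_not_near_indep sqfree_symbolic_squareE).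
by move=> W cW _; apply: ex; rewrite cW; lia.
Qed.

Lemma reg_le_reg_edge r r2 : is_reg (edge_ideal K e) r ->
  is_reg (sqfree_symbolic_power (edge_ideal K e) 2) r2 -> r2 <= r + 2.
Proof.
move=> reg; have r_ge2 := reg_edge_ge2 reg.
case: r reg r_ge2 => [d|//] reg d2.
have -> : Posz d + 2 = (d + 2)%N%:Z by [].
apply: reg_sqfree_symbolic_square_le => W t dt.
(* [exact_at_near_indep] raises the size by two and [exact_at_not_near] by one, which leaves
   [t - 3 >= d]. *)
have -> : t = (t - 3).+3 by lia.
apply: exact_at_not_near.
apply: (@exact_at_near_indep K n e e_sym e_irr d); [by lia| |by lia].
by move=> W' q dq; apply: (exact_at_indep_reg reg); lia.
Qed.

Lemma reg_le_matching r2 :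
  is_reg (sqfree_symbolic_power (edge_ideal K e) 2) r2 ->
  r2 <= (match_number e)%:Z + 2.
Proof.
have -> : (match_number e)%:Z + 2 = (match_number e + 2)%N%:Z by [].
apply: reg_sqfree_symbolic_square_le => W t dt.
(* Here each of the two steps raises the size by one, and [t - 2] exceeds the matching number. *)
have -> : t = (t - 2).+2 by lia.
apply: exact_at_not_near.
apply: exact_at_near_indep_matching => // M mM _.
have : (#|M| <= match_number e)%N.
  by apply: (leq_bigmax_cond (F := fun M : {set vset} => #|M|)).
lia.
Qed.

End EdgeIdeals.

Theorem theorem6p5 (K : fieldType) (n : nat) (e : rel 'I_n)
    (e_sym : ssrbool.symmetric e) (e_irr : ssrbool.irreflexive e) :
  (height_ge (edge_ideal K e) 2 ->
   forall r r2 : int,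
     is_reg (edge_ideal K e) r ->
     is_reg (sqfree_symbolic_power (edge_ideal K e) 2) r2 ->
     r2 <= Num.min (r + 2) ((match_number e)%:Z + 2)) /\
  ((exists2 f, sqfree_symbolic_power (edge_ideal K e) 2 f & f <> 0) ->
   forall r2 : int,
     is_reg (sqfree_symbolic_power (edge_ideal K e) 2) r2 ->
     r2 <= (match_number e)%:Z + 2).
Proof.
split=> [_ r r2 reg reg2|_ r2 reg2]; last exact: reg_le_matching reg2.
by rewrite le_min (reg_le_reg_edge e_sym e_irr reg reg2) (reg_le_matching e_sym e_irr reg2).
Qed.
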